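(* Let $M=\{0,1\}^{\mathbb{Z}}$ with the metric $d(x,y)=2^{-N(x,y)}$, where $N(x,y)=\sup\{N\ge 0: x_n=y_n \text{ for all } |n|<N\}$, and let $f:M\to M$ be the left shift $f((x_n)_{n})=(x_{n+1})_{n}$. Fix $p\in(0,1)$ and let $\mu_p=\nu_p^{\mathbb{Z}}$ be the Bernoulli product measure on $M$, where $\nu_p=p\delta_1+(1-p)\delta_0$. Let $\alpha>0$ and let $\eta,\sigma$ be real numbers with $1<\eta<\sigma$, such that $$2^{3\alpha}<\eta^2 \quad\text{and}\quad \frac{p}{1-p}\neq\frac{\log\eta}{\log\sigma}.$$ Define $A_{\sigma\eta}:M\to \mathrm{SL}(2,\mathbb{R})$ by $$A_{\sigma\eta}(x)=\begin{pmatrix}\eta^{-1}&0\\0&\eta\end{pmatrix}\text{ if }x_0=0,\qquad A_{\sigma\eta}(x)=\begin{pmatrix}\sigma&0\\0&\sigma^{-1}\end{pmatrix}\text{ if }x_0=1.$$ Then for every $\varepsilon>0$ there exists an $\alpha$-Hölder continuous map $B:M\to\mathrm{SL}(2,\mathbb{R})$ with $\|B-A_{\sigma\eta}\|_\alpha<\varepsilon$ and $\lambda_+(B,\mu_p)=\lambda_-(B,\mu_p)=0$. Consequently (since $\lambda_{\pm}(A_{\sigma\eta},\mu_p)=\pm|(1-p)\log\eta-p\log\sigma|\neq 0$), $A_{\sigma\eta}$ is a discontinuity point of the Lyapunov exponents (with respect to $\mu_p$) as functions on $C^{\alpha}(M,\mathrm{SL}(2,\mathbb{R}))$.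
   Context: A continuous map $A:M\to\mathrm{SL}(2,\mathbb{R})$ defines the linear cocycle $F_A(x,v)=(f(x),A(x)v)$ over $f$, with iterates $A^n(x)=A(f^{n-1}(x))\cdots A(x)$ for $n>0$. Its extremal Lyapunov exponents with respect to the ergodic $f$-invariant measure $\mu_p$ are the $\mu_p$-a.e. constant limits $\lambda_+(A,\mu_p)=\lim_{n\to\infty}\frac1n\log\|A^n(x)\|$ and $\lambda_-(A,\mu_p)=\lim_{n\to\infty}\frac1n\log\|A^n(x)^{-1}\|^{-1}$ (Euclidean norm and associated operator norm). $C^{\alpha}(M,\mathrm{SL}(2,\mathbb{R}))$ is the space of $\alpha$-Hölder continuous maps $A:M\to\mathrm{SL}(2,\mathbb{R})$ with the norm $\|A\|_\alpha=\sup_{x\in M}\|A(x)\|+\sup_{x\neq y}\frac{\|A(x)-A(y)\|}{d(x,y)^\alpha}$. *)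

(* Defs.v *)
From HB Require Import structures.
From mathcomp Require Import all_boot all_order all_algebra.
From mathcomp Require Import all_classical all_reals all_analysis.
Set Implicit Arguments. Unset Strict Implicit. Unset Printing Implicit Defensive.
Import Order.TTheory GRing.Theory Num.Theory.
Import numFieldNormedType.Exports.
Local Open Scope classical_set_scope.
Local Open Scope ring_scope.

(* The shift space M = {0,1}^Z; false = 0, true = 1. *)
Definition shiftspace := int -> bool.

Definition shift (x : shiftspace) : shiftspace := fun n => x (n + 1)%R.

Section Defs.
Variable R : realType.

(* d(x,y) = 2^{-N(x,y)}, N(x,y) = sup{N >= 0 : x_n = y_n for all |n| < N};
   written as the infimum of 2^{-N} over admissible N (= 0 when x = y). *)
Definition sdist (x y : shiftspace) : R :=
  inf [set ((2 : R) ^- N) | N in [set N : nat | forall n : int, (`|n| < N)%N -> x n = y n]].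

Definition vnorm (v : 'cV[R]_2) : R := Num.sqrt (v 0 0 ^+ 2 + v 1 0 ^+ 2).
Definition opnorm (A : 'M[R]_2) : R :=
  sup [set vnorm (A *m v) | v in [set v : 'cV[R]_2 | vnorm v = 1]].

Definition SL2_valued (A : shiftspace -> 'M[R]_2) := forall x, \det (A x) = 1.

Fixpoint cociter (A : shiftspace -> 'M[R]_2) (n : nat) (x : shiftspace) : 'M[R]_2 :=
  match n with
  | 0 => 1%:M
  | m.+1 => A (iter m shift x) *m cociter A m x
  end.

Definition holder_quot (alpha : R) (F : shiftspace -> 'M[R]_2) : set R :=
  [set r | exists x y : shiftspace, x <> y /\ r = opnorm (F x - F y) / powR (sdist x y) alpha].

Definition holder (alpha : R) (F : shiftspace -> 'M[R]_2) : Prop :=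
  has_ubound (range (fun x => opnorm (F x))) /\ has_ubound (holder_quot alpha F).

Definition holder_norm (alpha : R) (F : shiftspace -> 'M[R]_2) : R :=
  sup (range (fun x => opnorm (F x))) + sup (holder_quot alpha F).

(* Bernoulli measure mu_p on {0,1}^Z, via its outer measure on centred
   cylinders C(k,w) = {x | x_n = w_n for |n| <= k}, of mass
   prod_{|n|<=k} (p if w_n = 1 else 1-p). *)
Definition cylinder (k : nat) (w : shiftspace) : set shiftspace :=
  [set x | forall n : int, (`|n| <= k)%N -> x n = w n].

Definition cyl_weight (p : R) (k : nat) (w : shiftspace) : R :=
  \prod_(i < (k + k).+1) (if w (i%:Z - k%:Z)%R then p else 1 - p).

Definition bernoulli_null (p : R) (S : set shiftspace) : Prop :=
  forall e : R, 0 < e -> exists c : nat -> nat * shiftspace,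
    S `<=` \bigcup_(i in [set: nat]) cylinder (c i).1 (c i).2 /\
    forall N : nat, \sum_(i < N) cyl_weight p (c i).1 (c i).2 <= e.

Definition bernoulli_ae (p : R) (P : shiftspace -> Prop) : Prop :=
  bernoulli_null p [set x | ~ P x].

Definition lyap_plus_eq (p : R) (A : shiftspace -> 'M[R]_2) (l : R) : Prop :=
  bernoulli_ae p (fun x =>
    (fun n : nat => n%:R^-1 * ln (opnorm (cociter A n x))) @ \oo --> l).

Definition lyap_minus_eq (p : R) (A : shiftspace -> 'M[R]_2) (l : R) : Prop :=
  bernoulli_ae p (fun x =>
    (fun n : nat => n%:R^-1 * ln ((opnorm (invmx (cociter A n x)))^-1)) @ \oo --> l).

Definition A_se (sigma eta : R) (x : shiftspace) : 'M[R]_2 :=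
  if x 0%R then \matrix_(i < 2, j < 2) (if i == j then (if i == 0 then sigma else sigma^-1) else 0)
  else \matrix_(i < 2, j < 2) (if i == j then (if i == 0 then eta^-1 else eta) else 0).

End Defs.

(* Main.v *)
(* Let w be the word 0^n 1^n.  Reading w, A contracts the horizontal axis n times
   and then expands it n times.  Writing L(c), U(c) for the lower and upper
   unipotent matrices, the conjugates by powers of A satisfy
     L(t) D_1 U(u) D_0 L(s) = D_1 L(b) U(-1/b) L(b) D_0,
   with D_0, D_1 the two halves of the product, s = b/eta^(2n),
   t = b/sigma^(2n), u = -1/b, and L(b) U(-1/b) L(b) exchanges the two axes.  So
   three tiny shears per occurrence of w exchange the axes.  The outer ones see a
   window of radius 2n and the middle one a window of radius n; for
   b = 2^(n alpha) Lambda their Hölder cost is of order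
   Lambda (2^(3 alpha)/eta^2)^n and 1/Lambda.

   Up to a bounded coboundary the perturbed cocycle is monomial, and the log of
   its norm is |T_N| + O(1), where T_N is the Birkhoff sum of log a(x_k) with a
   sign reversed at each occurrence of w.  Two equiprobable blocks of letters
   with opposite signs and the same final letters show that the conditional mean
   of T_N is bounded, hence E[T_N^2] = O(N); Chebyshev along N = k^4 and
   Borel-Cantelli give T_N/N -> 0 almost everywhere. *)
Require Import Defs.
From HB Require Import structures.
From mathcomp Require Import all_boot all_order all_algebra.
From mathcomp Require Import all_classical all_reals all_analysis.
From mathcomp Require Import zify ring lra.
Import Order.TTheory GRing.Theory Num.Theory.
Import numFieldNormedType.Exports.
Local Open Scope classical_set_scope.
Local Open Scope ring_scope.
Set Implicit Arguments. Unset Strict Implicit. Unset Printing Implicit Defensive.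

(** * Expectation over Bernoulli words *)

Section WordExpectation.
Variables (R : realType) (p : R).
Hypotheses (p0 : 0 < p) (p1 : p < 1).

Definition bern (b : bool) : R := if b then p else 1 - p.

(** The mean over N independent letters, by recursion on the first letter, so that linearity and
    concatenation follow by induction. *)
Fixpoint expect (N : nat) (F : seq bool -> R) : R :=
  if N is N'.+1 then p * expect N' (fun u => F (true :: u))
                     + (1 - p) * expect N' (fun u => F (false :: u))
  else F [::].

Lemma bern_gt0 b : 0 < bern b.
Proof. by case: b => //=; rewrite /bern subr_gt0. Qed.

Lemma eq_expect N F G : (forall u, size u = N -> F u = G u) ->
  expect N F = expect N G.
Proof.
elim: N F G => [|N IH] F G h /=; first exact: h.
rewrite (IH (fun u => F (true :: u)) (fun u => G (true :: u))) => [|u su]; last by apply: h; rewrite /= su.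
by rewrite (IH (fun u => F (false :: u)) (fun u => G (false :: u))) => // u su; apply: h; rewrite /= su.
Qed.

Lemma ler_expect N F G : (forall u, size u = N -> F u <= G u) ->
  expect N F <= expect N G.
Proof.
elim: N F G => [|N IH] F G h /=; first exact: h.
have q0 : 0 <= 1 - p by rewrite subr_ge0 ltW.
apply: lerD; (apply: ler_wpM2l => //; first exact: ltW) || apply: ler_wpM2l => //.
  by apply: IH => u su; apply: h; rewrite /= su.
by apply: IH => u su; apply: h; rewrite /= su.
Qed.

Lemma expectD N F G : expect N (fun u => F u + G u) = expect N F + expect N G.
Proof. by elim: N F G => [|N IH] F G //=; rewrite !IH; ring. Qed.

Lemma expectZ N c F : expect N (fun u => c * F u) = c * expect N F.
Proof. by elim: N F => [|N IH] F //=; rewrite !IH; ring. Qed.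

Lemma expect_cst N c : expect N (fun=> c) = c.
Proof. by elim: N => [|N IH] //=; rewrite !IH; ring. Qed.

Lemma expectB N F G : expect N (fun u => F u - G u) = expect N F - expect N G.
Proof. by elim: N F G => [|N IH] F G //=; rewrite !IH; ring. Qed.

Lemma expect_norm N F c : (forall u, size u = N -> `|F u| <= c) ->
  `|expect N F| <= c.
Proof.
move=> h; rewrite ler_norml; apply/andP; split.
  rewrite -[X in X <= _](expect_cst N); apply: ler_expect => u /h.
  by rewrite ler_norml => /andP[].
rewrite -[X in _ <= X](expect_cst N); apply: ler_expect => u /h.
by rewrite ler_norml => /andP[].
Qed.

Lemma expect_cat M N F :
  expect (M + N) F = expect M (fun u => expect N (fun v => F (u ++ v))).
Proof. by elim: M F => [|M IH] F //=; rewrite !IH. Qed.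

Definition wprob (u : seq bool) : R := \prod_(b <- u) bern b.

Lemma wprob_gt0 u : 0 < wprob u.
Proof.
rewrite /wprob; elim: u => [|b u IH]; first by rewrite big_nil.
by rewrite big_cons mulr_gt0 // bern_gt0.
Qed.

Fixpoint words (N : nat) : seq (seq bool) :=
  if N is N'.+1 then map (cons true) (words N') ++ map (cons false) (words N')
  else [:: [::]].

Lemma mem_words u : u \in words (size u).
Proof.
elim: u => [|[] u IH] //=; rewrite mem_cat; apply/orP; [left|right];
  by apply: map_f.
Qed.

Lemma size_words N u : u \in words N -> size u = N.
Proof.
elim: N u => [|N IH] u /=; first by rewrite inE => /eqP ->.
by rewrite mem_cat => /orP[] /mapP[v /IH <- ->].
Qed.

Lemma expect_words N F : expect N F = \sum_(u <- words N) wprob u * F u.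
Proof.
elim: N F => [|N IH] F /=; first by rewrite big_seq1 /wprob big_nil mul1r.
rewrite big_cat !big_map /= !IH !mulr_sumr; congr (_ + _);
  by apply: eq_bigr => u _; rewrite /wprob big_cons mulrA.
Qed.

Lemma expect_pred1 u : expect (size u) (fun v => (v == u)%:R) = wprob u.
Proof.
elim: u => [|b u IH]; first by rewrite /= /wprob big_nil.
rewrite /wprob big_cons -/(wprob _) -IH; case: b; rewrite [LHS]/=.
  by rewrite [X in _ + _ * X]expect_cst mulr0 addr0.
by rewrite [X in _ * X + _]expect_cst mulr0 add0r.
Qed.

(** The words [u] and [v] have equal weight and opposite values of [g], so their contributions
    cancel; the remaining words have total mass 1 - 2 [wprob p u]. *)
Lemma expect_cancel u v (g : seq bool -> R) C :
  size v = size u -> u != v -> wprob v = wprob u ->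
  (forall w, size w = size u -> `|g w| <= C) -> g v = - g u ->
  `|expect (size u) g| <= (1 - 2 * wprob u) * C.
Proof.
move=> suv uv puv hg guv.
set h := fun w : seq bool => 1 - (w == u)%:R - (w == v)%:R : R.
have gE w : g w = g w * h w + (g u * (w == u)%:R - g u * (w == v)%:R).
  rewrite /h; case: (eqVneq w u) => [->|wu].
    by rewrite (negPf uv) /= !mulr1n; ring.
  case: (eqVneq w v) => [->|wv] /=; last by ring.
  by rewrite guv !mulr1n; ring.
rewrite (eq_expect (fun w _ => gE w)) expectD expectB !expectZ expect_pred1.
rewrite -suv expect_pred1 puv subrr addr0 suv.
have h0 w : 0 <= h w.
  rewrite /h; case: (eqVneq w u) => [->|wu].
    by rewrite (negPf uv) /= mulr1n; lra.
  by case: (eqVneq w v) => _ /=; rewrite ?mulr1n; lra.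
have hE : expect (size u) h = 1 - 2 * wprob u.
  rewrite /h !expectB expect_cst expect_pred1 -suv expect_pred1 puv; ring.
rewrite -hE mulrC -expectZ ler_norml; apply/andP; split.
  rewrite -mulN1r -expectZ; apply: ler_expect => w sw.
  have := hg w sw; rewrite ler_norml => /andP[a _].
  by rewrite mulN1r -mulNr ler_wpM2r.
apply: ler_expect => w sw; have := hg w sw; rewrite ler_norml => /andP[_ a].
by rewrite ler_wpM2r.
Qed.

End WordExpectation.

(** * Sign-alternating walks driven by a Bernoulli word *)

Section Walk.
Variables (R : realType) (p : R).
Hypotheses (p0 : 0 < p) (p1 : p < 1).
Variables (phi : bool -> R) (fire : seq bool -> bool).

(* [past] lists the letters already read, latest first; each firing reverses
   the sign of all the later increments. *)
Fixpoint walk (past u : seq bool) : R :=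
  if u is b :: v then phi b + (-1) ^+ fire (b :: past) * walk (b :: past) v
  else 0.

Fixpoint wsign (past u : seq bool) : R :=
  if u is b :: v then (-1) ^+ fire (b :: past) * wsign (b :: past) v else 1.

Lemma wsign_cat past u v :
  wsign past (u ++ v) = wsign past u * wsign (catrev u past) v.
Proof.
by elim: u past => [|b u IH] past /=; rewrite ?mul1r // IH mulrA.
Qed.

Lemma walk_cat past u v :
  walk past (u ++ v) = walk past u + wsign past u * walk (catrev u past) v.
Proof.
elim: u past => [|b u IH] past /=; first by rewrite add0r mul1r.
by rewrite IH mulrDr addrA mulrA.
Qed.

Lemma norm_wsign past u : `|wsign past u| = 1.
Proof.
elim: u past => [|b u IH] past /=; first by rewrite normr1.
by rewrite normrM IH normrX normrN1 expr1n mulr1.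
Qed.

Variable r : nat.
Hypothesis fire_take : forall l, fire (take r l) = fire l.

(** A firing sees only r letters, and the last r letters of the past determine every later
    window. *)
Lemma walk_take past past' u : take r past = take r past' ->
  walk past u = walk past' u.
Proof.
elim: u past past' => [|b u IH] past past' h //=.
have hb : take r (b :: past) = take r (b :: past').
  case: (r) h => //= r' h; congr cons.
  by rewrite -(take_takel _ (leqnSn r')) h take_takel.
by rewrite (IH _ _ hb) -(fire_take (b :: past)) hb fire_take.
Qed.

Variable Phi : R.
Hypothesis phi_le : forall b, `|phi b| <= Phi.

Lemma norm_walk past u : `|walk past u| <= (size u)%:R * Phi.
Proof.
elim: u past => [|b u IH] past /=; first by rewrite normr0 mul0r.
rewrite -natr1 mulrDl mul1r addrC (le_trans (ler_normD _ _)) // lerD //.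
by rewrite normrM normrX normrN1 expr1n mul1r.
Qed.

(* Two equiprobable blocks with opposite signs that lead to the same recent
   past cancel, so each further block contracts the mean. *)
Lemma walk_mean_bounded u v :
  size v = size u -> u != v -> wprob p v = wprob p u ->
  (forall past, wsign past v = - wsign past u) ->
  (forall past, take r (catrev v past) = take r (catrev u past)) ->
  exists C : R, forall N past, `|expect p N (walk past)| <= C.
Proof.
move=> suv uv puv sgn tk; set m := size u; set k := wprob p u.
have k0 : 0 < k by exact: wprob_gt0.
have Phi0 : 0 <= Phi by exact: le_trans (normr_ge0 _) (phi_le true).
have m0 : (0 < m)%N.
  rewrite /m; case: (u) uv suv => // uv /eqP; rewrite size_eq0 => /eqP vE.
  by rewrite vE in uv.
(* The number mΦ/(2k) solves mΦ + (1 - 2k)C = C; the extra mΦ covers words shorter than one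
   block. *)
pose C := m%:R * Phi * (1 + (2 * k)^-1).
have mC : m%:R * Phi <= C.
  rewrite /C -[X in X <= _]mulr1 ler_wpM2l ?mulr_ge0 //.
  by rewrite lerDl invr_ge0 mulr_ge0 // ltW.
have CE : m%:R * Phi + (1 - 2 * k) * C <= C.
  have -> : (1 - 2 * k) * C = C - 2 * k * (m%:R * Phi) - m%:R * Phi.
    by rewrite /C; field; rewrite gt_eqF.
  have : 0 <= 2 * k * (m%:R * Phi) by rewrite !mulr_ge0 // ltW.
  lra.
exists C => N; have [n] := ubnP N; elim: n N => // n IH N Nn past.
have [Nm|mN] := ltnP N m.
  apply: le_trans mC; apply: expect_norm => // w sw.
  apply: le_trans (norm_walk _ _) _; rewrite sw ler_wpM2r // ler_nat ltnW //.
rewrite -(subnKC mN) expect_cat.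
(* [h w] is the mean of the walk after a first block [w]. That block itself adds at most mΦ; the
   signed mean of [h] falls under [expect_cancel], since [u] and [v] leave the same recent past. *)
pose h w := expect p (N - m) (walk (catrev w past)).
rewrite (@eq_expect _ _ _ _ (fun w => walk past w + wsign past w * h w)); last first.
  move=> w sw; rewrite /h -expectZ -[X in X + _](expect_cst p (N - m)) -expectD.
  by apply: eq_expect => z sz; rewrite walk_cat.
rewrite expectD; apply: le_trans (ler_normD _ _) _; apply: le_trans CE.
apply: lerD.
  by apply: expect_norm => // w sw; rewrite (le_trans (norm_walk _ _)) // sw.
apply: (@expect_cancel _ _ _ _ _ v) => //.
  move=> w sw; rewrite normrM norm_wsign mul1r; apply: IH.
  by rewrite ltnS in Nn; apply: leq_trans Nn; rewrite ltn_subrL m0 (leq_trans m0).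
rewrite sgn mulNr; congr (- (_ * _)); apply: eq_expect => z _.
exact: walk_take.
Qed.

Variable C : R.
Hypothesis mean_le : forall N past, `|expect p N (walk past)| <= C.

(** Expand the square after the first letter: the cross term is 2 φ(b) times a signed mean of the
    remaining walk, so it is at most 2ΦC. Each letter thus adds at most Φ^2 + 2ΦC. *)
Lemma walk_second_moment N past :
  expect p N (fun u => walk past u ^+ 2) <= N%:R * (Phi ^+ 2 + 2 * Phi * C).
Proof.
have Phi0 : 0 <= Phi by exact: le_trans (normr_ge0 _) (phi_le true).
elim: N past => [|N IH] past; first by rewrite /= expr0n mul0r.
have step b : expect p N (fun u => walk past (b :: u) ^+ 2) <=
    N.+1%:R * (Phi ^+ 2 + 2 * Phi * C).
  rewrite (@eq_expect _ _ _ _ (fun u => phi b ^+ 2 +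
     ((2 * phi b * (-1) ^+ fire (b :: past)) * walk (b :: past) u +
      walk (b :: past) u ^+ 2))); last first.
    by move=> u _ /=; rewrite sqrrD exprMn sqrr_sign mul1r; ring.
  rewrite !expectD expect_cst expectZ -natr1 mulrDl mul1r addrC.
  have h1 : phi b ^+ 2 <= Phi ^+ 2.
    by rewrite -real_normK ?num_real // lerXn2r ?nnegrE.
  have h2 : 2 * phi b * (-1) ^+ fire (b :: past) * expect p N (walk (b :: past)) <=
     2 * Phi * C.
    apply: le_trans (ler_norm _) _; rewrite !normrM normrX normrN1 expr1n mulr1.
    rewrite (ger0_norm (_ : 0 <= 2)) // ler_pM ?mulr_ge0 //.
    by rewrite ler_wpM2l.
  have := IH (b :: past); lra.
rewrite [X in X <= _]/=.
have q0 : 0 <= 1 - p by rewrite subr_ge0 ltW.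
have := ler_wpM2l q0 (step false); have := ler_wpM2l (ltW p0) (step true).
rewrite /=; lra.
Qed.

Lemma walk_chebyshev N past (t : R) : 0 < t ->
  expect p N (fun u => (t < `|walk past u|)%R%:R) <=
  N%:R * (Phi ^+ 2 + 2 * Phi * C) / t ^+ 2.
Proof.
move=> t0; rewrite ler_pdivlMr ?exprn_gt0 // mulrC -expectZ.
apply: le_trans (walk_second_moment _ past); apply: ler_expect => // u _.
case: ltP => h; last by rewrite mulr0 sqr_ge0.
rewrite mulr1 -[leRHS]real_normK ?num_real //.
by rewrite lerXn2r ?nnegrE // ltW.
Qed.

End Walk.

(** * Null sets of the Bernoulli measure *)

Section NullSets.
Variables (R : realType) (p : R).

Lemma bernoulli_null_sub (S T : set shiftspace) :
  S `<=` T -> bernoulli_null p T -> bernoulli_null p S.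
Proof.
move=> ST nT e /nT[c [Tc hc]]; exists c; split => //.
exact: subset_trans Tc.
Qed.

Definition window (K : nat) (x : shiftspace) : seq bool :=
  mkseq (fun i => x (i%:Z - K%:Z)) (K + K).+1.

(** Outside [-K, K] the values are arbitrary: [absz] reflects positions to the left and [nth]
    returns [false] to the right. Only the cylinder of radius K is used. *)
Definition of_window (K : nat) (u : seq bool) : shiftspace :=
  fun n => nth false u (absz (n + K%:Z)).

Lemma cyl_weightE K w : cyl_weight p K w = wprob p (window K w).
Proof.
by rewrite /wprob /window /mkseq big_map -{1}[(K + K).+1]subn0 -/(index_iota 0 _) big_mkord.
Qed.

Lemma of_windowK K u : size u = (K + K).+1 -> window K (of_window K u) = u.
Proof.
move=> su; apply: (@eq_from_nth _ false); rewrite size_mkseq // => i hi.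
by rewrite nth_mkseq // /of_window subrK.
Qed.

Lemma cylinder_window K x : cylinder K (of_window K (window K x)) x.
Proof.
move=> n nK; rewrite /of_window nth_mkseq; last by lia.
by congr x; lia.
Qed.

(** Bridge from words to null sets: an event read off the window is covered by finitely many
    cylinders whose total weight is its probability. *)
Lemma cover_window K (Q : pred (seq bool)) :
  exists l : seq (nat * shiftspace),
    (forall x, Q (window K x) ->
       exists2 c, List.In c l & cylinder c.1 c.2 x) /\
    \sum_(c <- l) cyl_weight p c.1 c.2 =
      expect p (K + K).+1 (fun u => (Q u)%:R).
Proof.
exists [seq (K, of_window K u) | u <- words (K + K).+1 & Q u]; split.
  move=> x Qx; exists (K, of_window K (window K x)); last exact: cylinder_window.
  have : window K x \in [seq u <- words (K + K).+1 | Q u].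
    rewrite mem_filter Qx; have := mem_words (window K x).
    by rewrite size_mkseq.
  elim: [seq u <- _ | _] => // u s IH; rewrite inE => /orP[/eqP ->|/IH]; first by left.
  by right.
rewrite big_map big_filter expect_words big_mkcond.
apply: eq_big_seq => u /size_words su; rewrite cyl_weightE of_windowK //.
by case: (Q u); rewrite ?mulr1 ?mulr0.
Qed.

Hypotheses (p0 : 0 < p) (p1 : p < 1).

(** The cylinders around the zero sequence have weight (1 - p)^(2K+1), which tends to 0. *)
Lemma small_cylinder (e : R) : 0 < e -> exists c : nat * shiftspace,
  cyl_weight p c.1 c.2 <= e.
Proof.
move=> e0; have q1 : `|1 - p| < 1 by rewrite ger0_norm ?subr_ge0 ?(ltW p1) // ltrBlDr ltrDl.
have /cvgr0Pnorm_le/(_ _ e0)[K _ hK] := cvg_expr q1.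
exists (K, fun=> false); rewrite /cyl_weight /= prodr_const card_ord.
apply: le_trans (ler_norm _) _; apply: hK => /=; lia.
Qed.

Lemma nth_take_flatten (T : Type) (d : T) (l : nat -> seq T) m n i :
  (m <= n)%N -> (i < size (flatten (mkseq l m)))%N ->
  nth d (flatten (mkseq l n)) i = nth d (flatten (mkseq l m)) i.
Proof.
move=> mn hi; rewrite -(subnKC mn) /mkseq iotaD map_cat flatten_cat nth_cat.
by rewrite hi.
Qed.

(** The definition of a null set asks for one sequence of cylinders; concatenating finite lists
    produces it, with half of e spent on the lists and half on padding. *)
Lemma bernoulli_null_seq (S : set shiftspace) :
  (forall e : R, 0 < e -> exists l : nat -> seq (nat * shiftspace),
     (forall x, S x -> exists n, exists2 c, List.In c (l n) & cylinder c.1 c.2 x) /\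
     forall N, \sum_(n < N) \sum_(c <- l n) cyl_weight p c.1 c.2 <= e) ->
  bernoulli_null p S.
Proof.
move=> h e e0; have e2 : 0 < e / 2 by rewrite divr_gt0.
have [l [Sl wl]] := h _ e2.
(* each list is padded with a tiny cylinder, to make it nonempty *)
have [d hd] : {d : nat -> nat * shiftspace & forall n,
    cyl_weight p (d n).1 (d n).2 <= e / 2 * (2^-1) ^+ n.+1}.
  apply: (@choice _ _ (fun n c => cyl_weight p c.1 c.2 <= _)) => n.
  by apply: small_cylinder; rewrite mulr_gt0 // exprn_gt0 // invr_gt0.
pose l' n := d n :: l n.
have geo N : \sum_(n < N) (2^-1 : R) ^+ n.+1 = 1 - 2^-1 ^+ N.
  elim: N => [|N IH]; first by rewrite big_ord0 subrr.
  by rewrite big_ord_recr /= IH exprS; field.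
have sz N : (N <= size (flatten (mkseq l' N)))%N.
  elim: N => // N IH.
  by rewrite /mkseq -addn1 iotaD map_cat flatten_cat size_cat /= leq_add.
(* After padding, the first m + 1 lists contain more than m cylinders, so the default [d 0] is never
   returned and [c] enumerates the whole concatenation. *)
pose c m := nth (d 0) (flatten (mkseq l' m.+1)) m.
have cE m N : (m < size (flatten (mkseq l' N)))%N ->
    c m = nth (d 0) (flatten (mkseq l' N)) m.
  move=> mN; rewrite /c; have [NM|MN] := leqP N m.+1.
    exact: nth_take_flatten.
  by rewrite [RHS](@nth_take_flatten _ _ _ m.+1) // ltnW.
exists c; split.
  move=> x /Sl[n [b bl bx]].
  have : exists2 i, (i < size (flatten (mkseq l' n.+1)))%N &
      nth (d 0) (flatten (mkseq l' n.+1)) i = b.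
    rewrite /mkseq -addn1 iotaD map_cat flatten_cat /= add0n cats0.
    have [i hi <-] : exists2 i, (i < size (l' n))%N & nth (d 0) (l' n) i = b.
      rewrite /l'; elim: (d n :: l n) (or_intror bl : List.In b (d n :: l n)).
        by [].
      move=> a s IH [->|/IH[i si ib]]; first by exists 0.
      by exists i.+1.
    exists (size (flatten (mkseq l' n)) + i)%N.
      by rewrite size_cat ltn_add2l.
    by rewrite nth_cat ltnNge leq_addr /= addKn.
  by move=> [i si ib]; exists i => //=; rewrite (cE _ _ si) ib.
(* The first N terms of [c] lie in the first N padded lists. The padding there weighs at most e/2 by
   the geometric sum, the lists at most e/2 by [wl]. *)
move=> N; pose F := fun c : nat * shiftspace => cyl_weight p c.1 c.2.
have F0 b : 0 <= F b by apply: prodr_ge0 => i _; case: ifP => _; rewrite ?subr_ge0 ltW.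
have -> : \sum_(i < N) cyl_weight p (c i).1 (c i).2 =
    \sum_(b <- take N (flatten (mkseq l' N))) F b.
  rewrite (big_nth (d 0)) big_mkord size_takel //.
  apply: eq_bigr => i _; rewrite nth_take // -cE //.
  exact: leq_trans (sz _).
apply: (@le_trans _ _ (\sum_(b <- flatten (mkseq l' N)) F b)).
  rewrite -[X in _ <= \sum_(_ <- X) _](cat_take_drop N) big_cat /= lerDl.
  exact: sumr_ge0.
rewrite big_flatten big_map -{1}[N]subn0 -/(index_iota 0 _) big_mkord.
under eq_bigr => i _ do rewrite big_cons.
rewrite big_split /= [leRHS](splitr e) lerD //; last exact: wl.
apply: (@le_trans _ _ (\sum_(i < N) e / 2 * 2^-1 ^+ i.+1)).
  by apply: ler_sum => i _; exact: hd.
rewrite -mulr_sumr geo ler_piMr ?(ltW e2) //.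
Qed.

End NullSets.

(** * The strong law for sign-alternating sums *)

Section StrongLaw.
Variables (R : realType) (p : R).
Hypotheses (p0 : 0 < p) (p1 : p < 1).
Variables (phi : bool -> R) (fire : seq bool -> bool) (r : nat).

(** The walk along the orbit of [x], with the past read in [x] itself: [fire] receives x_0, x_(-1),
    ..., latest letter first. *)
Fixpoint alt_sum (N : nat) (x : shiftspace) : R :=
  if N is M.+1 then
    phi (x 0) + (-1) ^+ fire (mkseq (fun i => x (- i%:Z)) r) * alt_sum M (Defs.shift x)
  else 0.

Hypothesis fire_take : forall l, fire (take r l) = fire l.

(** The length L of the past is left free because it grows by one at each step of the induction. *)
Lemma alt_sum_walk N L x : (r <= L)%N ->
  alt_sum N x =
  walk phi fire (mkseq (fun i => x (- i.+1%:Z)) L) (mkseq (fun i => x i%:Z) N).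
Proof.
elim: N L x => // N IH L x rL /=.
have pE : x 0 :: mkseq (fun i => x (- i.+1%:Z)) L = mkseq (fun i => x (- i%:Z)) L.+1.
  by rewrite /mkseq /= oppr0 (iotaDl 1 0) -map_comp.
have fE : x 0 :: mkseq (fun i => x (- i.+1%:Z)) L =
    mkseq (fun i => Defs.shift x (- i.+1%:Z)) L.+1.
  by rewrite pE; apply: eq_map => i; rewrite /Defs.shift; congr x; lia.
have -> : mkseq (fun i => x (- i%:Z)) r =
    take r (x 0 :: mkseq (fun i => x (- i.+1%:Z)) L).
  by rewrite pE /mkseq -map_take take_iota (minn_idPl _) // ltnW.
rewrite fire_take (IH L.+1 _ (leqW rL)) -fE.
congr (_ + _ * walk _ _ _ _).
rewrite (iotaDl 1 0) -map_comp; apply: eq_map => i /=.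
by rewrite /Defs.shift; congr x; lia.
Qed.

Variable Phi : R.
Hypothesis phi_le : forall b, `|phi b| <= Phi.

Lemma norm_alt_sum N x : `|alt_sum N x| <= N%:R * Phi.
Proof.
by rewrite (@alt_sum_walk _ r) // (le_trans (norm_walk _ phi_le _ _)) // size_mkseq.
Qed.

Lemma alt_sum_incr N M x :
  `|alt_sum (N + M) x - alt_sum N x| <= M%:R * Phi.
Proof.
elim: N x => [|N IH] x /=; first by rewrite subr0 norm_alt_sum.
by rewrite opprD addrACA subrr add0r -mulrBr normrM normrX normrN1 expr1n mul1r.
Qed.

(** Interpolation between fourth powers: if k^4 <= N < (k+1)^4, then N - k^4 <= 15 k^3, so the sum
    at N is at most k^3 (1 + 15Φ). This is at most e N once k >= (1 + 15Φ)/e, whence [k1]. *)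
Lemma alt_sum_cvg k0 x :
  (forall k, (k0 <= k)%N -> `|alt_sum (k ^ 4) x| <= k%:R ^+ 3) ->
  (fun N => N%:R^-1 * alt_sum N x) @ \oo --> (0 : R).
Proof.
move=> hx; apply/cvgr0Pnorm_le => e e0.
have Phi0 : 0 <= Phi by exact: le_trans (normr_ge0 _) (phi_le true).
pose k1 := (maxn k0.+1 (Num.truncn ((1 + 15 * Phi) / e)).+1).
have k1e : 1 + 15 * Phi <= k1%:R * e.
  rewrite -ler_pdivrMr // (le_trans (ltW (truncnS_gt _))) // ler_nat.
  exact: leq_maxr.
exists (k1 ^ 4)%N => // N /= k1N.
have N0 : 0 < N%:R :> R.
  by rewrite ltr0n (leq_trans _ k1N) // expn_gt0 /k1 leq_max.
have Pex : exists k, (k ^ 4 <= N)%N by exists k1.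
have Pub k : (k ^ 4 <= N)%N -> (k <= N)%N.
  by move=> h; apply: leq_trans h; case: k => // k; rewrite -{1}(expn1 k.+1) leq_pexp2l.
case: (ex_maxnP Pex Pub) => k kN kmax.
have k1k : (k1 <= k)%N by exact: kmax.
have kgt0 : (0 < k)%N by apply: leq_trans k1k; rewrite /k1 leq_max.
have Nk : (N < k.+1 ^ 4)%N by rewrite ltnNge; apply/negP => /kmax; rewrite ltnn.
have dN : (N - k ^ 4 <= 15 * k ^ 3)%N.
  rewrite leq_subLR; apply: leq_trans (ltnW Nk) _.
  rewrite -(ler_nat R) natrD natrM !natrX -natr1.
  have y1 : 1 <= k%:R :> R by rewrite ler1n.
  have y2 : k%:R <= k%:R ^+ 2 :> R by rewrite ler_eXnr.
  have y3 : k%:R ^+ 2 <= k%:R ^+ 3 :> R by rewrite ler_weXn2l.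
  lra.
rewrite normrM normfV (ger0_norm (ltW N0)) ler_pdivrMl //.
have -> : alt_sum N x = alt_sum (k ^ 4) x + (alt_sum (k ^ 4 + (N - k ^ 4)) x - alt_sum (k ^ 4) x).
  by rewrite subnKC // addrCA subrr addr0.
apply: le_trans (ler_normD _ _) _.
have h1 : `|alt_sum (k ^ 4) x| <= k%:R ^+ 3.
  by apply: hx; apply: leq_trans k1k; rewrite leq_max ltnW.
apply: le_trans (lerD h1 (alt_sum_incr _ _ _)) _.
have h2 : (N - k ^ 4)%:R * Phi <= 15 * k%:R ^+ 3 * Phi.
  by rewrite ler_wpM2r // -natrX -natrM ler_nat.
apply: le_trans (lerD (lexx _) h2) _.
have -> : k%:R ^+ 3 + 15 * k%:R ^+ 3 * Phi = k%:R ^+ 3 * (1 + 15 * Phi) by ring.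
apply: (@le_trans _ _ (k%:R ^+ 3 * (k%:R * e))).
  by rewrite ler_wpM2l ?exprn_ge0 // (le_trans k1e) // ler_pM2r // ler_nat.
by rewrite mulrA -exprSr ler_wpM2r ?(ltW e0) // -natrX ler_nat.
Qed.

Variable C : R.
Hypothesis mean_le : forall N past, `|expect p N (walk phi fire past)| <= C.

Let D := Phi ^+ 2 + 2 * Phi * C.

(** Chebyshev at time N = k^4 and level k^3 gives N D / k^6 = D / k^2, which is summable. *)
Lemma alt_sum_tail k : (0 < k)%N ->
  exists l : seq (nat * shiftspace),
    (forall x, k%:R ^+ 3 < `|alt_sum (k ^ 4) x| ->
       exists2 c, List.In c l & cylinder c.1 c.2 x) /\
    \sum_(c <- l) cyl_weight p c.1 c.2 <= D / k%:R ^+ 2.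
Proof.
move=> k0; set N := (k ^ 4)%N; pose K := (N + r)%N.
(* The first K letters of the window, reversed, are the past; the next N drive the walk; the last r
   + 1 are integrated out. *)
pose Q u := k%:R ^+ 3 < `|walk phi fire (rev (take K u)) (take N (drop K u))|.
have [l [cl wl]] := cover_window p K Q; exists l; split.
  move=> x hx; apply: cl; rewrite /Q; move: hx.
  rewrite (@alt_sum_walk _ K) ?leq_addl //; set a := mkseq _ K; set b := mkseq _ N.
  have wE : window K x = rev a ++ mkseq (fun i => x i%:Z) K.+1.
    apply: (@eq_from_nth _ false).
      by rewrite size_cat size_rev !size_mkseq addnS.
    move=> i; rewrite size_mkseq => hi; rewrite nth_cat size_rev size_mkseq.
    rewrite [LHS]nth_mkseq //.
    case: ltnP => iK.
      rewrite nth_rev size_mkseq // /a nth_mkseq; last by lia.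
      by congr x; lia.
    by rewrite nth_mkseq; [congr x; lia|lia].
  have sa : size (rev a) = K by rewrite size_rev size_mkseq.
  rewrite wE -{2}sa take_size_cat ?sa // revK drop_size_cat //.
  by rewrite /mkseq -map_take take_iota (minn_idPl _) // leqW // leq_addr.
rewrite wl -addnS expect_cat -[leRHS](expect_cst p K); apply: ler_expect => // u su.
rewrite (_ : K.+1 = (N + r.+1)%N); last by rewrite /K addnS.
rewrite expect_cat.
rewrite (@eq_expect _ _ _ _ (fun v => (k%:R ^+ 3 < `|walk phi fire (rev u) v|)%R%:R)).
  apply: le_trans (walk_chebyshev p0 p1 phi_le mean_le _ _ _) _.
    by rewrite exprn_gt0 // ltr0n.
  rewrite -/D /N natrX -exprM le_eqVlt; apply/orP; left; apply/eqP.
  by field; rewrite pnatr_eq0 -lt0n.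
move=> v sv; rewrite -[RHS](expect_cst p r.+1); apply: eq_expect => z sz.
by rewrite /Q take_size_cat // drop_size_cat // take_size_cat.
Qed.

Theorem alt_sum_strong_law :
  bernoulli_ae p (fun x => (fun N => N%:R^-1 * alt_sum N x) @ \oo --> (0 : R)).
Proof.
have D0 : 0 <= D.
  rewrite addr_ge0 ?sqr_ge0 // !mulr_ge0 //.
    exact: le_trans (normr_ge0 _) (phi_le true).
  exact: le_trans (normr_ge0 _) (mean_le 0 [::]).
apply: bernoulli_null_seq => // e e0.
(* Borel-Cantelli: the events of index at least k0 = k1 + 1 have total weight at most D/k1 by
   telescoping, and [k1] makes this at most e. Outside them [alt_sum_cvg] applies. *)
pose k1 := (Num.truncn (D / e)).+1; pose k0 := k1.+1.
have k0e : D / k1%:R <= e.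
  rewrite ler_pdivrMr ?ltr0n // mulrC -ler_pdivrMr //.
  exact: ltW (truncnS_gt _).
have [l hl] : {l : nat -> seq (nat * shiftspace) & forall j,
    (forall x, (k0 + j)%:R ^+ 3 < `|alt_sum ((k0 + j) ^ 4) x| ->
       exists2 c, List.In c (l j) & cylinder c.1 c.2 x) /\
    \sum_(c <- l j) cyl_weight p c.1 c.2 <= D / (k0 + j)%:R ^+ 2}.
  apply: (@choice _ _ (fun j l => (forall x, (k0 + j)%:R ^+ 3 < `|alt_sum ((k0 + j) ^ 4) x| ->
       exists2 c, List.In c l & cylinder c.1 c.2 x) /\
    \sum_(c <- l) cyl_weight p c.1 c.2 <= D / (k0 + j)%:R ^+ 2)) => j.
  exact: alt_sum_tail.
exists l; split.
  move=> x nx; apply: contrapT => nex; apply: nx; apply: (@alt_sum_cvg k0) => k k0k.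
  rewrite leNgt; apply/negP => hk; apply: nex; exists (k - k0)%N.
  by apply: (hl _).1; rewrite subnKC.
move=> N.
(* 1/k^2 <= 1/(k-1) - 1/k *)
have tele M : \sum_(j < M) D / (k0 + j)%:R ^+ 2 <= D * (k1%:R^-1 - (k1 + M)%:R^-1).
  elim: M => [|M IH]; first by rewrite big_ord0 addn0 subrr mulr0.
  rewrite big_ord_recr /=; apply: le_trans (lerD IH (lexx _)) _.
  rewrite -mulrDr ler_wpM2l // addnS; set m := (_ + M)%N.
  have m0 : 0 < m%:R :> R by rewrite ltr0n.
  have : 0 <= m%:R^-1 - m.+1%:R^-1 - m.+1%:R ^- 2 :> R.
    have -> : m%:R^-1 - m.+1%:R^-1 - m.+1%:R ^- 2 = (m%:R * m.+1%:R ^+ 2)^-1 :> R.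
      by rewrite -natr1; field; rewrite !gt_eqF // addr_gt0.
    by rewrite invr_ge0 mulr_ge0 // exprn_ge0.
  rewrite -[(k0 + M)%N]/m.+1.
  suff key (x y z t : R) : 0 <= x - y - z -> t - x + z <= t - y by exact: key.
  lra.
apply: (@le_trans _ _ (\sum_(j < N) D / (k0 + j)%:R ^+ 2)).
  by apply: ler_sum => j _; exact: (hl j).2.
apply: le_trans (tele N) _; apply: le_trans k0e.
by rewrite ler_wpM2l // lerBlDr lerDl invr_ge0.
Qed.

End StrongLaw.

(** * Norms of 2x2 matrices, exponents and Hölder bounds *)

Section Norms.
Variable R : realType.

Definition mx2 (a b c d : R) : 'M[R]_2 :=
  \matrix_(i, j) if i == 0 then (if j == 0 then a else b)
                 else (if j == 0 then c else d).

Lemma mx2E a b c d : (mx2 a b c d 0 0 = a) * (mx2 a b c d 0 1 = b) *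
  (mx2 a b c d 1 0 = c) * (mx2 a b c d 1 1 = d).
Proof. by rewrite !mxE. Qed.

Lemma ord2 (i : 'I_2) : i = 0 \/ i = 1.
Proof. by case: i => [[|[|//]] hi]; [left|right]; apply: val_inj. Qed.

Lemma mx2_eta (A : 'M[R]_2) : A = mx2 (A 0 0) (A 0 1) (A 1 0) (A 1 1).
Proof.
by apply/matrixP => i j; case: (ord2 i) => ->; case: (ord2 j) => ->; rewrite mxE.
Qed.

Lemma mulmx2E (A B : 'M[R]_2) i j : (A *m B) i j = A i 0 * B 0 j + A i 1 * B 1 j.
Proof.
rewrite mxE big_ord_recl big_ord1; congr (_ + A i _ * B _ j);
  exact: val_inj.
Qed.

Lemma mulmx2 a b c d a' b' c' d' : mx2 a b c d *m mx2 a' b' c' d' =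
  mx2 (a * a' + b * c') (a * b' + b * d') (c * a' + d * c') (c * b' + d * d').
Proof. by rewrite [LHS]mx2_eta !mulmx2E !mx2E. Qed.

Lemma det2E (A : 'M[R]_2) : \det A = A 0 0 * A 1 1 - A 0 1 * A 1 0.
Proof.
rewrite (expand_det_row _ 0) big_ord_recl big_ord1 /cofactor !det_mx11 !mxE /=.
have -> : lift (0 : 'I_2) (0 : 'I_1) = 1 by exact: val_inj.
have -> : lift (1 : 'I_2) (0 : 'I_1) = 0 by exact: val_inj.
by rewrite addn0 expr0 mul1r expr1 mulN1r mulrN.
Qed.

Lemma mul1mx2 : 1%:M = mx2 1 0 0 1.
Proof. by rewrite [LHS]mx2_eta !mxE. Qed.

Lemma invmx2 (A : 'M[R]_2) : \det A = 1 ->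
  invmx A = mx2 (A 1 1) (- A 0 1) (- A 1 0) (A 0 0).
Proof.
move=> dA; have uA : A \in unitmx by rewrite unitmxE dA unitr1.
rewrite -[RHS]mul1mx -(mulVmx uA) -mulmxA.
suff -> : A *m mx2 (A 1 1) (- A 0 1) (- A 1 0) (A 0 0) = 1%:M by rewrite mulmx1.
rewrite {1}(mx2_eta A) mulmx2 mul1mx2; move: dA; rewrite det2E => dA.
by congr mx2; rewrite -?dA; ring.
Qed.

(** Entrywise substitute for [opnorm]: it agrees with it up to a factor 4 and is invariant under
    inversion when the determinant is 1. *)
Definition l1norm (A : 'M[R]_2) : R :=
  `|A 0 0| + `|A 0 1| + `|A 1 0| + `|A 1 1|.

Lemma l1norm_ge0 A : 0 <= l1norm A.
Proof. by rewrite !addr_ge0. Qed.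

Lemma l1norm0 : l1norm 0 = 0.
Proof. by rewrite /l1norm !mxE normr0 !addr0. Qed.

Lemma l1normD A B : l1norm (A + B) <= l1norm A + l1norm B.
Proof.
rewrite /l1norm !mxE.
have := ler_normD (A 0 0) (B 0 0); have := ler_normD (A 0 1) (B 0 1).
have := ler_normD (A 1 0) (B 1 0); have := ler_normD (A 1 1) (B 1 1); lra.
Qed.

Lemma l1normN A : l1norm (- A) = l1norm A.
Proof. by rewrite /l1norm !mxE !normrN. Qed.

Lemma l1normB A B : l1norm (A - B) <= l1norm A + l1norm B.
Proof. by rewrite -(l1normN B) l1normD. Qed.

Lemma l1normM A B : l1norm (A *m B) <= l1norm A * l1norm B.
Proof.
have h i j : `|(A *m B) i j| <= `|A i 0| * `|B 0 j| + `|A i 1| * `|B 1 j|.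
  by rewrite mulmx2E -!normrM ler_normD.
apply: le_trans (lerD (lerD (lerD (h 0 0) (h 0 1)) (h 1 0)) (h 1 1)) _.
rewrite /l1norm.
have p i j k l : 0 <= `|A i j| * `|B k l| by rewrite mulr_ge0.
have := (p 0 0 1 0, p 0 0 1 1, p 0 1 0 0, p 0 1 0 1).
have := (p 1 0 1 0, p 1 0 1 1, p 1 1 0 0, p 1 1 0 1).
move=> [[[? ?] ?] ?] [[[? ?] ?] ?]; rewrite -subr_ge0.
rewrite [X in 0 <= X](_ : _ = `|A 0 0| * `|B 1 0| + `|A 0 0| * `|B 1 1|
  + `|A 0 1| * `|B 0 0| + `|A 0 1| * `|B 0 1| + `|A 1 0| * `|B 1 0|
  + `|A 1 0| * `|B 1 1| + `|A 1 1| * `|B 0 0| + `|A 1 1| * `|B 0 1|); last by ring.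
by rewrite !addr_ge0.
Qed.

Lemma l1norm_invmx A : \det A = 1 -> l1norm (invmx A) = l1norm A.
Proof. by move=> /invmx2 ->; rewrite /l1norm !mx2E !normrN; ring. Qed.

Lemma l1norm_ge1 A : \det A = 1 -> 1 <= l1norm A.
Proof.
rewrite det2E => dA.
have h : 1 <= `|A 0 0| * `|A 1 1| + `|A 0 1| * `|A 1 0|.
  by rewrite -!normrM -[X in X <= _]normr1 -dA ler_normB.
rewrite -(ler_pXn2r (ltn0Sn 1)) ?nnegrE ?l1norm_ge0 // expr1n.
apply: le_trans h _; rewrite /l1norm.
have := (normr_ge0 (A 0 0), normr_ge0 (A 0 1), normr_ge0 (A 1 0), normr_ge0 (A 1 1)).
move: `|A 0 0| `|A 0 1| `|A 1 0| `|A 1 1| => a b c d [[[a0 b0] c0] d0].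
have := (mulr_ge0 a0 b0, mulr_ge0 a0 c0, mulr_ge0 a0 d0, mulr_ge0 b0 c0,
  mulr_ge0 b0 d0, mulr_ge0 c0 d0).
have := (mulr_ge0 a0 a0, mulr_ge0 b0 b0, mulr_ge0 c0 c0, mulr_ge0 d0 d0).
move=> [[[? ?] ?] ?] [[[[[? ?] ?] ?] ?] ?]; rewrite expr2 !mulrDl !mulrDr; lra.
Qed.

Lemma vnorm_le (v : 'cV[R]_2) : vnorm v <= `|v 0 0| + `|v 1 0|.
Proof.
rewrite /vnorm -[leRHS]ger0_norm ?addr_ge0 // -sqrtr_sqr ler_wsqrtr //.
rewrite sqrrD !real_normK ?num_real // -addrA [_ *+ 2 + _]addrC addrA lerDl.
by rewrite mulrn_wge0 // mulr_ge0.
Qed.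

Lemma vnorm_ge (v : 'cV[R]_2) i : `|v i 0| <= vnorm v.
Proof.
rewrite /vnorm -sqrtr_sqr ler_wsqrtr //; case: (ord2 i) => ->.
  by rewrite lerDl sqr_ge0.
by rewrite lerDr sqr_ge0.
Qed.

Lemma vnorm_mul_le (A : 'M[R]_2) v : vnorm v = 1 -> vnorm (A *m v) <= l1norm A.
Proof.
move=> v1; apply: le_trans (vnorm_le _) _.
have h i : `|(A *m v) i 0| <= `|A i 0| + `|A i 1|.
  rewrite mxE big_ord_recl big_ord1.
  have -> : lift (0 : 'I_2) (0 : 'I_1) = 1 by exact: val_inj.
  apply: le_trans (ler_normD _ _) _; rewrite !normrM.
  by rewrite lerD // ler_piMr // -v1 vnorm_ge.
by have := lerD (h 0) (h 1); rewrite /l1norm; lra.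
Qed.

Lemma opnorm_le (A : 'M[R]_2) : opnorm A <= l1norm A.
Proof.
apply: ge_sup; last by move=> _ [v /= v1 <-]; exact: vnorm_mul_le.
exists (vnorm (A *m delta_mx 0 0)); exists (delta_mx 0 0) => //=.
by rewrite /vnorm !mxE /= expr1n expr0n addr0 sqrtr1.
Qed.

Lemma opnorm_ge (A : 'M[R]_2) i j : `|A i j| <= opnorm A.
Proof.
apply: le_trans (ub_le_sup _ _); last first.
- exists (delta_mx j 0) => //=.
  by rewrite /vnorm !mxE /=; case: (ord2 j) => -> /=;
    rewrite expr1n expr0n ?addr0 ?add0r sqrtr1.
- by exists (l1norm A) => _ [v /= v1 <-]; exact: vnorm_mul_le.
by apply: le_trans (vnorm_ge _ i); rewrite -colE mxE.
Qed.

Lemma opnorm_ge_l1 (A : 'M[R]_2) : l1norm A / 4 <= opnorm A.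
Proof.
have := opnorm_ge A 0 0; have := opnorm_ge A 0 1.
have := opnorm_ge A 1 0; have := opnorm_ge A 1 1; rewrite /l1norm; lra.
Qed.

(** * Cocycle products and their exponents *)

Lemma det_cociter (F : shiftspace -> 'M[R]_2) n x : SL2_valued F ->
  \det (cociter F n x) = 1.
Proof.
by move=> hF; elim: n => [|n IH] /=; rewrite ?det1 // det_mulmx hF IH mul1r.
Qed.

Lemma cociterS (F : shiftspace -> 'M[R]_2) n x :
  cociter F n.+1 x = cociter F n (Defs.shift x) *m F x.
Proof.
elim: n x => [|n IH] x; first by rewrite /= mulmx1 mul1mx.
by rewrite [LHS]/= -/(cociter F n.+1 x) IH mulmxA -iterS iterSr.
Qed.

Lemma cvg_invnM (c : R) : (fun n : nat => n%:R^-1 * c) @ \oo --> (0 : R).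
Proof.
rewrite -[X in _ --> X](mul0r c); apply: cvgM; last exact: cvg_cst.
by rewrite -(cvg_shiftS (fun n : nat => n%:R^-1 : R)); exact: cvg_harmonic.
Qed.

(** The factor 4 between the two norms disappears after division by n, and a matrix of determinant 1
    has the same [l1norm] as its inverse; hence both exponents come from one squeeze. *)
Lemma exponents_squeeze (X : nat -> 'M[R]_2) (L U : nat -> R) l :
  (forall n, \det (X n) = 1) ->
  (forall n, L n <= ln (l1norm (X n)) <= U n) ->
  (fun n => n%:R^-1 * L n) @ \oo --> l -> (fun n => n%:R^-1 * U n) @ \oo --> l ->
  ((fun n => n%:R^-1 * ln (opnorm (X n))) @ \oo --> l) /\
  ((fun n => n%:R^-1 * ln (opnorm (invmx (X n)))^-1) @ \oo --> - l).
Proof.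
move=> dX LU Ll Ul.
have main (Y : nat -> R) : (forall n, l1norm (X n) / 4 <= Y n <= l1norm (X n)) ->
    (fun n => n%:R^-1 * ln (Y n)) @ \oo --> l.
  move=> hY.
  have Ll' : (fun n : nat => n%:R^-1 * (L n - ln 4)) @ \oo --> l.
    rewrite (_ : (fun n => _) = (fun n => n%:R^-1 * L n - n%:R^-1 * ln 4)); last first.
      by apply: funext => n; rewrite mulrBr.
    rewrite -[X in _ --> X]subr0; apply: cvgB => //.
    exact: cvg_invnM.
  apply: (squeeze_cvgr _ Ll' Ul); near=> n.
  have X1 : 0 < l1norm (X n) by apply: lt_le_trans (l1norm_ge1 (dX n)).
  have /andP[Y1 Y2] := hY n; have /andP[L1 U1] := LU n.
  have Y0 : 0 < Y n by apply: lt_le_trans Y1; rewrite divr_gt0.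
  have n0 : 0 <= n%:R^-1 :> R by rewrite invr_ge0.
  apply/andP; split; apply: ler_wpM2l => //; last first.
    by apply: le_trans U1; rewrite ler_ln.
  rewrite lerBlDr; apply: le_trans L1 _.
  by rewrite -lnM ?posrE // ler_ln ?posrE ?mulr_gt0 // -ler_pdivrMr.
split; first by apply: main => n; rewrite opnorm_ge_l1 opnorm_le.
rewrite (_ : (fun n => _) = (fun n => - (n%:R^-1 * ln (opnorm (invmx (X n)))))).
  apply: cvgN; apply: main => n.
  by rewrite -(l1norm_invmx (dX n)) opnorm_ge_l1 opnorm_le.
apply: funext => n; rewrite -mulrN lnV // posrE.
apply: lt_le_trans (opnorm_ge_l1 _); rewrite l1norm_invmx // divr_gt0 //.
exact: lt_le_trans (l1norm_ge1 (dX n)).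
Unshelve. all: by end_near.
Qed.

(** * Hölder bounds for locally constant maps *)

Lemma sdist_ge (x y : shiftspace) (r : nat) k :
  (absz k <= r)%N -> x k <> y k -> 2 ^- r <= sdist R x y.
Proof.
move=> kr xy; apply: lb_le_inf; first by exists (2 ^- 0); exists 0%N => // n.
move=> _ [N /= hN <-]; rewrite lef_pV2 ?posrE ?exprn_gt0 //.
rewrite ler_weXn2l ?ler1n // leqNgt; apply/negP => rN.
by apply: xy; apply: hN; exact: leq_ltn_trans rN.
Qed.

Lemma sdist_ge0 (x y : shiftspace) : 0 <= sdist R x y.
Proof.
apply: lb_le_inf; first by exists (2 ^- 0); exists 0%N => // n.
by move=> _ [N /= hN <-]; rewrite invr_ge0 exprn_ge0.
Qed.

Variable alpha : R.
Hypothesis alpha0 : 0 < alpha.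

Definition holder_l1 (H : R) (F : shiftspace -> 'M[R]_2) :=
  forall x y, l1norm (F x - F y) <= H * powR (sdist R x y) alpha.

Lemma holder_l1D H G F1 F2 : holder_l1 H F1 -> holder_l1 G F2 ->
  holder_l1 (H + G) (fun x => F1 x + F2 x).
Proof.
move=> h1 h2 x y; rewrite opprD addrACA mulrDl.
by apply: le_trans (l1normD _ _) _; apply: lerD.
Qed.

(** Either the windows of radius r agree and the difference is 0, or the distance is at least 2^(-r)
    and its α-th power at least 2^(-rα). *)
Lemma holder_l1_local r c F : 0 <= c ->
  (forall x y, (forall k, (absz k <= r)%N -> x k = y k) -> F x = F y) ->
  (forall x y, l1norm (F x - F y) <= c) ->
  holder_l1 (c * (powR 2 alpha) ^+ r) F.
Proof.
move=> c0 loc hc x y; case: (pselect (forall k, (absz k <= r)%N -> x k = y k)).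
  move=> /loc ->; rewrite subrr l1norm0 mulr_ge0 ?powR_ge0 //.
  by rewrite mulr_ge0 // exprn_ge0 // powR_ge0.
move=> /existsNP[k /not_implyP[kr xy]].
apply: le_trans (hc _ _) _; rewrite -mulrA ler_peMr //.
have q0 : 0 < powR 2 alpha :> R by rewrite powR_gt0.
rewrite mulrC -ler_pdivrMr ?exprn_gt0 // mul1r.
have -> : (powR 2 alpha ^+ r)^-1 = powR (2 ^- r) alpha :> R.
  rewrite -!powR_mulrn ?powR_ge0 // -!powRN -!powRrM.
  by rewrite mulrN mulrC mulNr.
by rewrite ge0_ler_powR ?nnegrE ?sdist_ge0 ?(ltW alpha0) ?invr_ge0 ?exprn_ge0 // (sdist_ge kr xy).
Qed.

Lemma holder_l1_norm H K F : 0 <= H -> holder_l1 H F ->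
  (forall x, l1norm (F x) <= K) ->
  holder alpha F /\ holder_norm alpha F <= K + H.
Proof.
move=> H0 hH hK.
have b1 : ubound (range (fun x => opnorm (F x))) K.
  by move=> _ [x _ <-]; exact: le_trans (opnorm_le _) (hK x).
have b2 : ubound (holder_quot alpha F) H.
  move=> _ [x [y [_ ->]]].
  (* If the denominator vanishes, the quotient is 0 by the convention on inverses, and H is
     nonnegative. *)
  have [d0|d0] := ltP 0 (powR (sdist R x y) alpha).
    by rewrite ler_pdivrMr // (le_trans (opnorm_le _)).
  by rewrite (le_anti (introT andP (conj d0 (powR_ge0 _ _)))) invr0 mulr0.
split; first by split; [exists K|exists H].
apply: lerD; apply: ge_sup => //.
  by exists (opnorm (F (fun=> true))); exists (fun=> true).
pose x : shiftspace := fun=> true; pose y : shiftspace := fun=> false.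
exists (opnorm (F x - F y) / powR (sdist R x y) alpha); exists x, y; split => //.
by move=> /(congr1 (fun z => z 0)).
Qed.

End Norms.

(** * The unperturbed cocycle *)

Lemma bernoulli_ae_imp (R : realType) (p : R) (P Q : shiftspace -> Prop) :
  (forall x, Q x -> P x) -> bernoulli_ae p Q -> bernoulli_ae p P.
Proof.
by move=> QP; apply: bernoulli_null_sub => x /= nP Qx; apply: nP; exact: QP.
Qed.

Section Unperturbed.
Variables (R : realType) (p eta sigma : R).
Hypotheses (p0 : 0 < p) (p1 : p < 1) (eta1 : 1 < eta) (eta_sigma : eta < sigma).

Definition stretch (b : bool) : R := if b then sigma else eta^-1.
Definition lstretch (b : bool) : R := if b then ln sigma else - ln eta.

Let eta0 : 0 < eta. Proof. exact: lt_trans eta1. Qed.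
Let sigma0 : 0 < sigma. Proof. exact: lt_trans eta_sigma. Qed.

Lemma expR_lstretch b : expR (lstretch b) = stretch b.
Proof. by case: b; rewrite /= ?expRN lnK. Qed.

Lemma stretch_gt0 b : 0 < stretch b.
Proof. by rewrite -expR_lstretch expR_gt0. Qed.

Lemma A_seE x : A_se sigma eta x = mx2 (stretch (x 0)) 0 0 (stretch (x 0))^-1.
Proof.
by rewrite /A_se /stretch [LHS]mx2_eta; case: (x 0); rewrite !mxE /= ?invrK.
Qed.

Lemma SL2_A_se : SL2_valued (A_se sigma eta).
Proof.
by move=> x; rewrite A_seE det2E !mx2E mulr0 subr0 divff // gt_eqF // stretch_gt0.
Qed.

Let m := p * ln sigma - (1 - p) * ln eta.

(** With [fire] constantly false, [alt_sum] is an ordinary Birkhoff sum, here centred by the mean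
    [m], so the law for alternating sums applies to it. *)
Lemma cociter_A_se N x : cociter (A_se sigma eta) N x =
  let S := alt_sum (fun b => lstretch b - m) (fun=> false) 0 N x + N%:R * m in
  mx2 (expR S) 0 0 (expR (- S)).
Proof.
elim: N x => [|N IH] x; first by rewrite /= mul0r addr0 oppr0 expR0 mul1mx2.
rewrite cociterS IH A_seE mulmx2 !mulr0 !mul0r !addr0 !add0r /=.
set T := alt_sum _ _ _ _ _; rewrite mul1r.
have -> : lstretch (x 0) - m + T + N.+1%:R * m = T + N%:R * m + lstretch (x 0).
  by rewrite -natr1; ring.
by rewrite !expRN !expRD expR_lstretch !invfM.
Qed.

Lemma A_se_exponents : lyap_plus_eq p (A_se sigma eta) `|m| /\
  lyap_minus_eq p (A_se sigma eta) (- `|m|).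
Proof.
pose psi b := lstretch b - m.
have mean0 N past : `|expect p N (walk psi (fun=> false) past)| <= 0.
  suff -> : expect p N (walk psi (fun=> false) past) = 0 by rewrite normr0.
  elim: N past => //= N IH past.
  rewrite !expectD !expect_cst !expectZ !IH /psi /= /m; ring.
have psi_le b : `|psi b| <= `|psi true| + `|psi false|.
  by case: b; rewrite ?lerDl ?lerDr.
have slln := @alt_sum_strong_law _ p p0 p1 psi (fun=> false) 0 (fun l => erefl) _ psi_le _ mean0.
have expo x : (fun N => N%:R^-1 * alt_sum psi (fun=> false) 0 N x) @ \oo --> (0 : R) ->
   ((fun n => n%:R^-1 * ln (opnorm (cociter (A_se sigma eta) n x))) @ \oo --> `|m|) /\
   ((fun n => n%:R^-1 * ln (opnorm (invmx (cociter (A_se sigma eta) n x)))^-1) @ \oo --> - `|m|).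
  move=> hx; pose S N := alt_sum psi (fun=> false) 0 N x + N%:R * m.
  have S1 : (fun N => N%:R^-1 * `|S N|) @ \oo --> `|m|.
    have : (fun N => `|N%:R^-1 * alt_sum psi (fun=> false) 0 N x + m|) @ \oo --> `|m|.
      by apply: cvg_norm; rewrite -[X in _ --> X]add0r; apply: cvgD => //; exact: cvg_cst.
    (* The two sequences are compared from N = 1 on, since N^-1 N is 0 at N = 0. *)
    apply: cvg_trans; apply: near_eq_cvg; exists 1%N => // N /= N1.
    rewrite -{2}(ger0_norm (_ : 0 <= N%:R^-1 :> R)) ?invr_ge0 // -normrM; congr (`| _ |).
    by rewrite /S mulrDr mulrA mulVf ?mul1r // pnatr_eq0 -lt0n.
  have inv0 : (fun N : nat => N%:R^-1 * ln 2) @ \oo --> (0 : R).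
    exact: cvg_invnM.
  apply: (@exponents_squeeze _ _ (fun N => `|S N|) (fun N => `|S N| + ln 2)) => //.
  - by move=> N; apply: det_cociter; exact: SL2_A_se.
  - move=> N; rewrite cociter_A_se /= -/psi -/(S N) /l1norm !mx2E normr0 !addr0.
    rewrite !(ger0_norm (expR_ge0 _)).
    have h1 : expR `|S N| <= expR (S N) + expR (- S N).
      by case: (ger0P (S N)) => _; rewrite ?lerDl ?lerDr expR_ge0.
    have h2 : expR (S N) + expR (- S N) <= expR `|S N| * 2.
      rewrite mulrDr mulr1; apply: lerD; rewrite ler_expR ?ler_norm //.
      by rewrite -normrN ler_norm.
    have e0 : 0 < expR (S N) + expR (- S N) by rewrite addr_gt0 ?expR_gt0.
    rewrite -{1}(expRK `|S N|) -{2}(expRK `|S N|) -lnM ?posrE ?expR_gt0 //.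
    by rewrite !ler_ln ?posrE ?expR_gt0 ?mulr_gt0 ?expR_gt0 // h1.
  - rewrite (_ : (fun N => _) = (fun N => N%:R^-1 * `|S N| + N%:R^-1 * ln 2)).
      by rewrite -[X in _ --> X]addr0; exact: cvgD.
    by apply: funext => N; rewrite mulrDr.
by split; apply: bernoulli_ae_imp slln => x /expo[].
Qed.

End Unperturbed.

(** * Occurrences of the word 0^n 1^n *)

Section Occurrences.
Variable n : nat.
Hypothesis n1 : (1 < n)%N.
Local Notation final := (n + n).-1.

Lemma n_gt0 : (0 < n)%N. Proof. exact: ltnW. Qed.
Lemma n_lt_nn : (n < n + n)%N. Proof. lia. Qed.
Lemma nn_gt0 : (0 < n + n)%N. Proof. lia. Qed.
Lemma final_lt : (final < n + n)%N. Proof. lia. Qed.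
Lemma finalS : final.+1 = (n + n)%N. Proof. lia. Qed.
Lemma n_lt_final : (n < final)%N. Proof. lia. Qed.
Lemma final_subn : (final - n)%N = n.-1. Proof. lia. Qed.

Lemma zeros_place i : (0 < i < n)%N ->
  [/\ (n <= i)%N = false, (n == i) = false, (0%N == i) = false &
      (final == i) = false].
Proof. by move=> hi; split; lia. Qed.

Lemma ones_place i : (n < i < final)%N ->
  [/\ (n <= i)%N, (n == i) = false, (0%N == i) = false & (final == i) = false].
Proof. by move=> hi; split; lia. Qed.

Lemma place_cases i : (i < n + n)%N ->
  [\/ i = 0%N, (0 < i < n)%N, i = n | (n < i < final)%N \/ i = final].
Proof.
move=> hi; have [i0|i0] := posnP i; first by constructor 1.
have [iln|nli|ieqn] := ltngtP i n.
- by constructor 2; apply/andP.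
- by constructor 4; lia.
- by constructor 3.
Qed.

(* [x] sits at place [i] of the word 0^n 1^n. *)
Definition occ (i : nat) (x : shiftspace) : bool :=
  [forall j : 'I_(n + n), x (j%:Z - i%:Z) == (n <= j)%N].

Lemma occP i x : reflect (forall j, (j < n + n)%N -> x (j%:Z - i%:Z) = (n <= j)%N)
  (occ i x).
Proof.
apply: (iffP forallP) => [h j hj|h j]; first exact: eqP (h (Ordinal hj)).
by apply/eqP; exact: h.
Qed.

Lemma occ_letter i x : (i < n + n)%N -> occ i x -> x 0 = (n <= i)%N.
Proof. by move=> hi /occP/(_ i hi); rewrite subrr. Qed.

(** The word 0^n 1^n does not overlap itself: a shift by at most n would put a 1 on its last 0, a
    larger one would put a 1 on its first 0. *)
Lemma occ_uniq i k x : (i < n + n)%N -> (k < n + n)%N -> occ i x ->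
  occ k x = (k == i).
Proof.
move=> hi hk oi; apply/idP/eqP => [|-> //].
wlog ik : i k hi hk oi / (i < k)%N => [h ok|].
  by have [ik|ki|//] := ltngtP i k; [apply: h|symmetry; apply: (h k i)].
move=> ok; have /occP h1 := oi; have /occP h2 := ok.
have eqw j : (j + (k - i) < n + n)%N -> (n <= j + (k - i))%N = (n <= j)%N.
  move=> hj; rewrite -h2 // -h1; last by lia.
  by congr x; lia.
have [kn|nk] := leqP (k - i) n.
  by have := eqw n.-1; lia.
by have := eqw 0%N; lia.
Qed.

Lemma occ_shift i x : occ i.+1 (Defs.shift x) = occ i x.
Proof.
apply: eq_forallb => j; rewrite /Defs.shift; congr (x _ == _); lia.
Qed.

(** Seen from place i the word covers the positions from -i to 2n - 1 - i; the two inequalities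
    place them in [-r, r]. *)
Lemma occ_local i x y r : (i <= r)%N -> (n + n <= r.+1 + i)%N ->
  (forall k, (absz k <= r)%N -> x k = y k) -> occ i x = occ i y.
Proof.
move=> ir nr xy; apply: eq_forallb => j; rewrite xy //.
by have := ltn_ord j; lia.
Qed.

(** The past is listed latest first, so the word appears reversed, as 1^n 0^n. *)
Definition firing (l : seq bool) : bool :=
  take (n + n) l == mkseq (fun i => (i < n)%N) (n + n).

Lemma firing_take l : firing (take (n + n) l) = firing l.
Proof. by rewrite /firing take_takel. Qed.

Lemma firing_nth l i : firing l -> (i < n + n)%N -> nth false l i = (i < n)%N.
Proof. by move=> /eqP h hi; rewrite -(nth_take _ hi) h nth_mkseq. Qed.

Lemma firing_occ x : firing (mkseq (fun i => x (- i%:Z)) (n + n)) = occ final x.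
Proof.
apply/idP/occP => [h j hj|h].
  have jf : (final - j < n + n)%N by lia.
  have := firing_nth h jf; rewrite nth_mkseq // => hx.
  rewrite (_ : j%:Z - _ = - ((n + n).-1 - j)%N%:Z); last by lia.
  by rewrite hx; lia.
rewrite /firing take_oversize ?size_mkseq //; apply/eqP.
apply: (@eq_from_nth _ false); rewrite !size_mkseq // => i hi.
rewrite !nth_mkseq // (_ : - i%:Z = (final - i)%N%:Z - final%:Z); last first.
  by lia.
by rewrite h; lia.
Qed.

Variable R : realType.

Lemma wsign_zeros past k : wsign R firing past (nseq k false) = 1.
Proof.
elim: k past => //= k IH past; rewrite IH mulr1.
suff -> : firing (false :: past) = false by [].
by apply/negP => h; have := @firing_nth _ 0 h; rewrite /=; lia.
Qed.

(** An occurrence ends in exactly n ones preceded by a 0, so a longer run of ones does not fire. *)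
Lemma wsign_ones_ones past m k : (n <= m)%N ->
  wsign R firing (nseq m true ++ past) (nseq k true) = 1.
Proof.
elim: k m => //= k IH m nm; rewrite -[true :: _ ++ _]/(nseq m.+1 true ++ past).
rewrite IH ?leqW // mulr1.
suff -> : firing (nseq m.+1 true ++ past) = false by [].
apply/negP => h; have := @firing_nth _ n h; rewrite nth_cat size_nseq ltnS nm nth_nseq ltnS nm; lia.
Qed.

Lemma wsign_zeros_ones past m k : (k.+1 + m = n)%N ->
  wsign R firing (nseq m true ++ nseq n false ++ past) (nseq k.+1 true) = -1.
Proof.
elim: k m => [|k IH] m km; rewrite [LHS]/= -[true :: _ ++ _]/(nseq m.+1 true ++ _).
  rewrite mulr1 (_ : m.+1 = n) // (_ : firing _ = true) // /firing catA.
  rewrite take_size_cat ?size_cat ?size_nseq //; apply/eqP.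
  apply: (@eq_from_nth _ false); rewrite size_cat !size_nseq ?size_mkseq // => i hi.
  by rewrite nth_mkseq // nth_cat size_nseq !nth_nseq; case: ltnP => //; case: ltnP.
rewrite -[X in _ * X]/(wsign R firing (nseq m.+1 true ++ nseq n false ++ past) (nseq k.+1 true)).
rewrite IH; last by rewrite -km; lia.
suff -> : firing (nseq m.+1 true ++ nseq n false ++ past) = false by rewrite mul1r.
apply/negP => h; have := @firing_nth _ m.+1 h.
by rewrite nth_cat size_nseq ltnn subnn nth_cat size_nseq nth_nseq n_gt0; lia.
Qed.

End Occurrences.

(** * The perturbed cocycle *)

Section Perturbation.
Variables (R : realType) (eta sigma b : R) (n : nat).
Hypotheses (eta1 : 1 < eta) (eta_sigma : eta < sigma) (b0 : 0 < b) (n1 : (1 < n)%N).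
Local Notation final := (n + n).-1.
Local Notation occ := (occ n).
Local Notation firing := (firing n).

Let eta0 : 0 < eta. Proof. exact: lt_trans eta1. Qed.
Let sigma0 : 0 < sigma. Proof. exact: lt_trans eta_sigma. Qed.

(** L(s) acts before the first letter of an occurrence, U(u) before its first 1 and L(t) after its
    last letter; multiplying by A yields the factors eta and sigma in [pert]. *)
Let s := b / (eta ^+ 2) ^+ n.
Let t := b / (sigma ^+ 2) ^+ n.
Let u := - b^-1.
Let a (x : shiftspace) := stretch eta sigma (x 0).

Let s0 : 0 < s. Proof. by rewrite divr_gt0 // !exprn_gt0. Qed.
Let t0 : 0 < t. Proof. by rewrite divr_gt0 // !exprn_gt0. Qed.
Let a0 x : 0 < a x. Proof. exact: stretch_gt0. Qed.

(* [A_se] times a small shear at the first letter, at the middle and at the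
   last letter of each occurrence of 0^n 1^n. *)
Definition pert (x : shiftspace) : 'M[R]_2 :=
  mx2 (a x) (sigma * u * (occ n x)%:R)
      (eta * s * (occ 0 x)%:R + sigma * t * (occ final x)%:R) (a x)^-1.

(* The monomial cocycle cohomologous to [pert]: it exchanges the axes at the
   end of each occurrence. *)
Definition swap (x : shiftspace) : 'M[R]_2 :=
  if occ final x then mx2 0 (- (t * a x)^-1) (t * a x) 0
  else mx2 (a x) 0 0 (a x)^-1.

(* U(v) L(c); by this factor the products of [pert] and [swap] over the first
   i letters of an occurrence differ. *)
Definition shears (v c : R) : 'M[R]_2 := mx2 (1 + v * c) v c 1.

(** The shears accumulated before the letter at place i is read. Passing A multiplies a lower shear
    by eta^2 at a 0 and divides it by sigma^2 at a 1, where an upper shear is multiplied by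
    sigma^2. *)
Definition upper_shear (i : nat) : R :=
  if (i <= n)%N then 0 else u * (sigma ^+ 2) ^+ (i - n).

Definition lower_shear (i : nat) : R :=
  if i == 0%N then 0 else if (i <= n)%N then s * (eta ^+ 2) ^+ i
  else b / (sigma ^+ 2) ^+ (i - n).

Definition transfer (x : shiftspace) : 'M[R]_2 :=
  if [pick i : 'I_(n + n) | occ i x] is Some i
  then shears (upper_shear i) (lower_shear i) else 1%:M.

Lemma det_shears v c : \det (shears v c) = 1.
Proof. by rewrite det2E !mx2E; ring. Qed.

Lemma transfer_occ i x : (i < n + n)%N -> occ i x ->
  transfer x = shears (upper_shear i) (lower_shear i).
Proof.
move=> hi oi; rewrite /transfer; case: pickP => [k ok|/(_ (Ordinal hi))/=].
  by have := ltn_ord k; move: ok; rewrite (occ_uniq n1 hi _ oi) // => /eqP ->.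
by rewrite oi.
Qed.

Lemma transfer_fresh x : (forall i, (0 < i < n + n)%N -> ~~ occ i x) ->
  transfer x = 1%:M.
Proof.
move=> h; rewrite /transfer; case: pickP => [i oi|//].
have -> : nat_of_ord i = 0%N.
  apply/eqP; rewrite -leqn0 leqNgt; apply/negP => i0.
  by have := h i; rewrite i0 ltn_ord oi => /(_ isT).
by rewrite /upper_shear /lower_shear /= /shears mulr0 addr0 mul1mx2.
Qed.

Lemma det_transfer x : \det (transfer x) = 1.
Proof. by rewrite /transfer; case: pickP => *; rewrite ?det_shears ?det1. Qed.

Lemma transfer_bounded : exists K : R, forall x, l1norm (transfer x) <= K.
Proof.
pose f (i : 'I_(n + n)) := l1norm (shears (upper_shear i) (lower_shear i)).
exists (\sum_i f i + l1norm 1%:M) => x; rewrite /transfer; case: pickP => [i _|_].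
  rewrite (bigD1 i) //= -addrA lerDl addr_ge0 ?l1norm_ge0 // sumr_ge0 // => k _.
  exact: l1norm_ge0.
by rewrite lerDr sumr_ge0 // => k _; exact: l1norm_ge0.
Qed.

Lemma upper_shear_le i : (i <= n)%N -> upper_shear i = 0.
Proof. by rewrite /upper_shear => ->. Qed.

Lemma upper_shear_gt i : (n < i)%N -> upper_shear i = u * (sigma ^+ 2) ^+ (i - n).
Proof. by rewrite ltnNge /upper_shear => /negPf ->. Qed.

Lemma lower_shear_le i : (0 < i)%N -> (i <= n)%N ->
  lower_shear i = s * (eta ^+ 2) ^+ i.
Proof. by rewrite /lower_shear => /gtn_eqF -> ->. Qed.

Lemma lower_shear_gt i : (n < i)%N -> lower_shear i = b / (sigma ^+ 2) ^+ (i - n).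
Proof.
move=> ni; have n0 := leq_ltn_trans (leq0n n) ni.
by rewrite /lower_shear (gtn_eqF n0) leqNgt ni.
Qed.

(** Checked letter by letter: [occ_uniq] leaves one place i, which is place i + 1 of the shifted
    point, so each case is an explicit identity of 2x2 matrices. *)
Lemma pert_coboundary x :
  pert x *m transfer x = transfer (Defs.shift x) *m swap x.
Proof.
have sN0 : sigma != 0 by rewrite gt_eqF.
have eN0 : eta != 0 by rewrite gt_eqF.
have bN0 : b != 0 by rewrite gt_eqF.
have sXN0 k : (sigma ^+ 2) ^+ k != 0 by rewrite gt_eqF // !exprn_gt0.
have eXN0 k : (eta ^+ 2) ^+ k != 0 by rewrite gt_eqF // !exprn_gt0.
have fresh : (forall i, (i < final)%N -> ~~ occ i x) -> transfer (Defs.shift x) = 1%:M.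
  move=> h; apply: transfer_fresh => -[//|i] /andP[_ hi]; rewrite (occ_shift n1).
  by apply: h; rewrite -ltnS (finalS n1).
have [i' oi|no] := pickP (fun k : 'I_(n + n) => occ k x); last first.
  have no' k : (k < n + n)%N -> occ k x = false.
    by move=> hk; exact: (no (Ordinal hk)).
  rewrite transfer_fresh; last by move=> k /andP[_ hk]; rewrite no'.
  rewrite fresh; last by move=> k hk; rewrite no' // (ltn_trans hk) // final_lt.
  rewrite mulmx1 mul1mx /swap /pert (no' _ (n_lt_nn n1)) (no' _ (nn_gt0 n1)).
  by rewrite (no' _ (final_lt n1)) !mulr0 addr0.
move: (ltn_ord i') oi; move: (nat_of_ord i') => i hi oi.
have ax : a x = if (n <= i)%N then sigma else eta^-1.
  by rewrite /a (occ_letter hi oi); case: ifP.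
have tS : (i.+1 < n + n)%N ->
    transfer (Defs.shift x) = shears (upper_shear i.+1) (lower_shear i.+1).
  by move=> hi1; apply: transfer_occ => //; rewrite (occ_shift n1).
rewrite (transfer_occ hi oi) /pert /swap.
rewrite (occ_uniq n1 hi (n_lt_nn n1) oi) (occ_uniq n1 hi (nn_gt0 n1) oi).
rewrite (occ_uniq n1 hi (final_lt n1) oi) ax.
have n0 := n_gt0 n1; have nf := n_lt_final n1; have fS := finalS n1.
have [i0|iz|iN|[io|iF]] := place_cases n1 hi.
- rewrite i0 in tS *; rewrite tS; last by rewrite -fS ltnS (leq_trans _ nf).
  rewrite leqNgt n0 (gtn_eqF n0) (gtn_eqF (ltn_trans n0 nf)) eqxx.
  rewrite !upper_shear_le // (lower_shear_le (ltn0Sn 0)) // /lower_shear eqxx expr1.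
  by rewrite /shears /= !mulmx2 mulr1n mulr0n; congr mx2; field; rewrite ?eN0.
- have [-> -> -> ->] := zeros_place n1 iz; have /andP[i0 iln] := iz.
  rewrite tS; last by rewrite -fS ltnS (leq_trans iln) // ltnW.
  rewrite (upper_shear_le (ltnW iln)) (upper_shear_le iln).
  rewrite (lower_shear_le i0 (ltnW iln)) (lower_shear_le _ iln) // [_ ^+ i.+1]exprS.
  by rewrite /shears /= !mulmx2 mulr0n; congr mx2; field; rewrite ?eN0.
(* Here the lower shear has grown to s eta^(2n) = b, and U(-1/b) enters next to L(b). *)
- rewrite iN in tS *; rewrite tS; last by rewrite -fS ltnS.
  rewrite leqnn eqxx (ltn_eqF n0) (gtn_eqF nf) (upper_shear_le (leqnn n)).
  rewrite (upper_shear_gt (ltnSn n)) (lower_shear_gt (ltnSn n)) subSnn expr1.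
  rewrite (lower_shear_le n0 (leqnn n)) /s divfK // /shears /= !mulmx2 mulr1n mulr0n /u.
  by congr mx2; field; rewrite ?sN0 ?bN0 ?eXN0.
- have [-> -> -> ->] := ones_place n1 io; have /andP[nli iLf] := io.
  rewrite tS; last by rewrite -fS ltnS.
  rewrite (upper_shear_gt nli) (upper_shear_gt (leqW nli)).
  rewrite (lower_shear_gt nli) (lower_shear_gt (leqW nli)) subSn ?(ltnW nli) // ![_ ^+ (i - n).+1]exprS.
  rewrite /shears /= !mulmx2 mulr0n /u.
  by congr mx2; field; rewrite ?sN0 ?bN0 ?sXN0.
(* At the last letter the product of upper and lower shear is -1, which kills one diagonal entry,
   and [t] is the value that kills the other; nothing is left to transfer. *)
rewrite iF in oi hi *; rewrite fresh; last first.
  by move=> k hk; rewrite (occ_uniq n1 hi (ltn_trans hk hi) oi) (ltn_eqF hk).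
rewrite eqxx (ltn_eqF nf) (ltn_eqF (ltn_trans n0 nf)) (ltnW nf).
rewrite (upper_shear_gt nf) (lower_shear_gt nf) final_subn //.
have nE : (sigma ^+ 2) ^+ n = sigma ^+ 2 * (sigma ^+ 2) ^+ n.-1.
  by rewrite -exprS prednK.
rewrite mul1mx /shears /= !mulmx2 /t nE mulr1n mulr0n /u.
by congr mx2; field; rewrite ?sN0 ?bN0 ?sXN0.
Qed.

(** By [occ_uniq] the two off-diagonal entries are never nonzero together. *)
Lemma SL2_pert : SL2_valued pert.
Proof.
move=> x; rewrite /pert det2E !mx2E divff ?gt_eqF ?a0 //.
have [on|on] := boolP (occ n x); last by rewrite mulr0 mul0r subr0.
have n0 := n_gt0 n1; have nf := n_lt_final n1.
rewrite (occ_uniq n1 (n_lt_nn n1) (nn_gt0 n1) on) (ltn_eqF n0).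
rewrite (occ_uniq n1 (n_lt_nn n1) (final_lt n1) on) (gtn_eqF nf).
by rewrite !mulr0 addr0 mulr0 subr0.
Qed.

(** * Growth of the perturbed products *)

Lemma cociter_pert N x :
  cociter pert N x *m transfer x = transfer (iter N Defs.shift x) *m cociter swap N x.
Proof.
elim: N => [|N IH] /=; first by rewrite mul1mx mulmx1.
by rewrite -mulmxA IH !mulmxA pert_coboundary.
Qed.

Let T := alt_sum (lstretch eta sigma) firing (n + n).

(** An exchange at the first letter swaps the roles of e^T and e^(-T) in the remaining product, as
    the sign in [alt_sum] does. The factors t cancel in pairs, so at most one survives. *)
Lemma cociter_swap N x : let M := cociter swap N x in
  [/\ M 0 1 = 0, M 1 0 = 0, `|M 0 0| = expR (T N x) & `|M 1 1| = expR (- T N x)] \/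
  [/\ M 0 0 = 0, M 1 1 = 0, `|M 1 0| = t * expR (T N x) &
      `|M 0 1| = t^-1 * expR (- T N x)].
Proof.
elim: N x => [|N IH] x M; rewrite /M.
  by left; rewrite /= !mxE /= /T /= oppr0 expR0 normr1.
rewrite cociterS /T /= (firing_occ n1) -/T -/(T N _).
have ea := expR_lstretch eta1 eta_sigma (x 0).
move: (IH (Defs.shift x)); move: (cociter swap N _) (T N _) => M' T' hM.
have an : `|a x| = a x by rewrite gtr0_norm.
have tn : `|t| = t by rewrite gtr0_norm.
rewrite !mulmx2E /swap; case: (occ final x); rewrite !mx2E !mulr0 ?addr0 ?add0r ?expr1 ?expr0 ?mul1r ?mulN1r;
  move: hM tn t0; move: (t) => c hM tn c0;
  move: ea an (a0 x); rewrite -/(a x); move: (a x) (lstretch _ _ (x 0)) => d l ea an d0.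
  rewrite opprB ![expR (_ - _)]expRD ea.
  case: hM => -[-> -> h1 h2]; [right|left]; split; rewrite ?mul0r //;
    rewrite !normrM ?normrN ?normfV ?normrM ?an ?tn ?h1 ?h2 !expRN ?ea;
    by field; rewrite ?gt_eqF ?expR_gt0.
rewrite opprD ![expR (_ + _)]expRD ea.
case: hM => -[-> -> h1 h2]; [left|right]; split; rewrite ?mul0r //;
  rewrite !normrM ?normfV an ?h1 ?h2 ?expRN ?ea; by field; rewrite ?gt_eqF ?expR_gt0.
Qed.

(** The lower bound is the determinant; the upper one combines the bounded transfer with
    [cociter_swap], the constant [c] covering both the diagonal and the antidiagonal shape. *)
Lemma pert_growth : exists K : R, forall N x,
  0 <= ln (l1norm (cociter pert N x)) <= `|T N x| + K.
Proof.
have [K hK] := transfer_bounded.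
have K1 : 1 <= K by apply: le_trans (hK (fun=> true)); rewrite l1norm_ge1 // det_transfer.
have K0 : 0 < K by apply: lt_le_trans K1.
pose c := 2 + t + t^-1.
have c0 : 0 < c by rewrite !addr_gt0 // invr_gt0.
exists (ln (K * (c * K))) => N x.
have g1 : 1 <= l1norm (cociter pert N x).
  by rewrite l1norm_ge1 // det_cociter //; exact: SL2_pert.
rewrite ln_ge0 //= -{1}(expRK `|T N x|) -lnM ?posrE ?expR_gt0 ?mulr_gt0 //.
rewrite ler_ln ?posrE ?mulr_gt0 ?expR_gt0 //; last exact: lt_le_trans g1.
have uC : transfer x \in unitmx by rewrite unitmxE det_transfer unitr1.
rewrite -[cociter pert N x](mulmxK uC) cociter_pert.
apply: le_trans (l1normM _ _) _; rewrite l1norm_invmx ?det_transfer // mulrC.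
rewrite [leRHS](_ : _ = K * (K * (c * expR `|T N x|))); last by ring.
apply: ler_pM; rewrite ?l1norm_ge0 //.
apply: le_trans (l1normM _ _) _; apply: ler_pM; rewrite ?l1norm_ge0 //.
have e1 : expR (T N x) <= expR `|T N x| by rewrite ler_expR ler_norm.
have e2 : expR (- T N x) <= expR `|T N x| by rewrite ler_expR -normrN ler_norm.
have e3 := expR_gt0 `|T N x|.
have ti : 0 < t^-1 by rewrite invr_gt0.
rewrite /l1norm /c; case: (cociter_swap N x) => -[-> -> -> ->]; rewrite normr0.
  have : 0 <= (t + t^-1) * expR `|T N x| by rewrite mulr_ge0 ?addr_ge0 // ltW.
  lra.
have := ler_wpM2l (ltW t0) e1; have := ler_wpM2l (ltW ti) e2; lra.
Qed.

(** * Vanishing of the exponents of the perturbation *)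

Section Vanishing.
Variable p : R.
Hypotheses (p0 : 0 < p) (p1 : p < 1).

Lemma pert_mean_bounded : exists C : R,
  forall N past, `|expect p N (walk (lstretch eta sigma) firing past)| <= C.
Proof.
(* Both words have the same letter counts. The initial 1^n acts alike in both; then 0^n 1^n fires
   once in [w1], while 1^n 0^n never fires in [w2]. The final 2n zeros erase the memory. *)
pose w1 := nseq n true ++ nseq n false ++ nseq n true ++ nseq (n + n) false.
pose w2 := nseq n true ++ nseq n true ++ nseq n false ++ nseq (n + n) false.
have catrevn k c l : catrev (nseq k c) l = nseq k c ++ l.
  by rewrite catrevE rev_nseq.
apply: (@walk_mean_bounded _ p p0 p1 _ firing (n + n) (@firing_take n)
  (ln sigma + ln eta) _ w1 w2).
- have ls : 0 <= ln sigma by rewrite ln_ge0 // ltW // (lt_trans eta1).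
  have le : 0 <= ln eta by rewrite ln_ge0 // ltW.
  by case; rewrite /lstretch ?normrN ger0_norm // ?lerDl ?lerDr.
- by rewrite !size_cat !size_nseq.
- apply/negP => /eqP /(congr1 (fun l => nth true l n)).
  by rewrite !nth_cat !size_nseq !ltnn !subnn !nth_nseq (n_gt0 n1).
- by rewrite /wprob !big_cat /=; ring.
- move=> past; rewrite !wsign_cat !catrevn !(wsign_zeros n1) (wsign_ones_ones n1) //.
  have nE : n = n.-1.+1 by rewrite prednK // ltnW.
  have := @wsign_zeros_ones n n1 R (nseq n true ++ past) 0 n.-1.
  rewrite cat0s addn0 -nE => -> //; ring.
- move=> past; rewrite !catrevE !rev_cat !rev_nseq -!catA.
  by rewrite !take_size_cat ?size_nseq.
Qed.

Lemma pert_exponents : lyap_plus_eq p pert 0 /\ lyap_minus_eq p pert 0.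
Proof.
have [C mean_le] := pert_mean_bounded.
have [K hK] := pert_growth.
have phi_le c : `|lstretch eta sigma c| <= `|ln sigma| + `|ln eta|.
  by case: c; rewrite /= ?normrN ?lerDl ?lerDr.
have slln := alt_sum_strong_law p0 p1 (@firing_take n) phi_le mean_le.
have expo x : (fun N => N%:R^-1 * T N x) @ \oo --> (0 : R) ->
   ((fun m => m%:R^-1 * ln (opnorm (cociter pert m x))) @ \oo --> (0 : R)) /\
   ((fun m => m%:R^-1 * ln (opnorm (invmx (cociter pert m x)))^-1) @ \oo --> - (0 : R)).
  move=> hx; apply: (@exponents_squeeze _ _ (fun=> 0) (fun N => `|T N x| + K)).
  - by move=> N; apply: det_cociter; exact: SL2_pert.
  - by move=> N; exact: hK.
  - by under eq_fun do rewrite mulr0; exact: cvg_cst.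
  rewrite (_ : (fun N => _) = (fun N => `|N%:R^-1 * T N x| + N%:R^-1 * K)).
    rewrite -[X in _ --> X]addr0; apply: cvgD; last exact: cvg_invnM.
    by rewrite -[X in _ --> X](@normr0 R R); exact: cvg_norm.
  by apply: funext => N; rewrite mulrDr normrM (ger0_norm (_ : 0 <= N%:R^-1 :> R)) ?invr_ge0.
split; apply: bernoulli_ae_imp slln => x /expo[] //.
by rewrite oppr0.
Qed.

End Vanishing.

(** * Hölder size of the perturbation *)

Variable alpha : R.
Hypothesis alpha0 : 0 < alpha.

Let q := powR 2 alpha : R.

(** [K] bounds the difference and [H] its Hölder constant, one summand per shear; the exponents of
    [q] are the window radii allowed for the shears. *)
Lemma pert_holder :
  let K := eta * s + sigma / b + sigma * t in
  let H := eta * s * q ^+ (n + n) + sigma / b * q ^+ n + sigma * t * q ^+ (n + n) in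
  holder alpha pert /\
  holder_norm alpha (fun x => pert x - A_se sigma eta x) <= K + H.
Proof.
move=> K H.
have q0 : 0 <= q by exact: powR_ge0.
have c1 : 0 <= eta * s by rewrite mulr_ge0 ?ltW.
have c2 : 0 <= sigma / b by rewrite divr_ge0 ?ltW.
have c3 : 0 <= sigma * t by rewrite mulr_ge0 ?ltW.
have H0 : 0 <= H by rewrite !addr_ge0 // mulr_ge0 // exprn_ge0.
have diffE x : pert x - A_se sigma eta x =
    mx2 0 0 (eta * s * (occ 0 x)%:R) 0 + mx2 0 (sigma * u * (occ n x)%:R) 0 0 +
    mx2 0 0 (sigma * t * (occ final x)%:R) 0.
  rewrite A_seE /pert -/(a x) [LHS]mx2_eta [RHS]mx2_eta !mxE /=.
  by congr mx2; ring.
have bn (c : bool) : `|c%:R| <= 1 :> R by case: c; rewrite ?normr1 ?normr0.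
have bd (c c' : bool) : `|c%:R - c'%:R| <= 1 :> R.
  by case: c; case: c'; rewrite ?subrr ?sub0r ?subr0 ?normrN ?normr1 ?normr0.
have hl k r (c : R) (lo : bool) : (k <= r)%N -> (n + n <= r.+1 + k)%N ->
    let f x := if lo then mx2 0 0 (c * (occ k x)%:R) 0 else mx2 0 (c * (occ k x)%:R) 0 0 in
    holder_l1 alpha (`|c| * q ^+ r) f.
  move=> kr nr f; apply: holder_l1_local => // [x y xy|x y].
    by rewrite /f (occ_local n1 kr nr xy).
  rewrite /f {f}; case: lo; rewrite /l1norm !mxE /= subrr normr0 ?addr0 ?add0r;
    by rewrite -mulrBr normrM ler_piMr.
have absu : `|sigma * u| = sigma / b.
  by rewrite normrM /u normrN normfV !gtr0_norm.
have hH : holder_l1 alpha H (fun x => pert x - A_se sigma eta x).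
  move=> x y; rewrite !diffE.
  have leS k : (n + n <= (n + n).+1 + k)%N.
    exact: leq_trans (leqnSn _) (leq_addr _ _).
  have h1 := hl 0%N _ (eta * s) true (leq0n _) (leS _).
  have h2 := hl n n (sigma * u) false (leqnn _) (leq_add (leqnSn n) (leqnn n)).
  have h3 := hl final _ (sigma * t) true (leq_pred _) (leS _).
  rewrite (ger0_norm c1) in h1; rewrite absu in h2; rewrite (ger0_norm c3) in h3.
  exact: (holder_l1D (holder_l1D h1 h2) h3).
have hK x : l1norm (pert x - A_se sigma eta x) <= K.
  rewrite diffE; apply: le_trans (l1normD _ _) _; apply: lerD.
    apply: le_trans (l1normD _ _) _; apply: lerD;
      rewrite /l1norm !mx2E !normr0 ?addr0 ?add0r normrM ?absu ?(ger0_norm c1);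
      by rewrite ler_piMr.
  by rewrite /l1norm !mx2E !normr0 ?addr0 ?add0r normrM (ger0_norm c3) ler_piMr.
split; last by have [] := holder_l1_norm H0 hH hK.
pose k := sigma + sigma^-1 + eta + eta^-1.
have k0 : 0 <= k by rewrite !addr_ge0 ?invr_ge0 // ltW.
have hA x : l1norm (A_se sigma eta x) <= k.
  have ? : 0 < sigma^-1 by rewrite invr_gt0.
  have ? : 0 < eta^-1 by rewrite invr_gt0.
  have := eta0; have := sigma0.
  rewrite A_seE -/(a x) /l1norm !mx2E normr0 !addr0 normfV gtr0_norm //.
  rewrite /a /stretch /k; case: (x 0) => ? ?; rewrite ?invrK; lra.
(* [A_se] depends on x_0 alone, a window of radius 0; adding the difference shows that [pert] is
   Hölder. *)
have hAl : holder_l1 alpha ((k + k) * q ^+ 0) (A_se sigma eta).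
  apply: holder_l1_local => //; first by rewrite addr_ge0.
    by move=> x y xy; rewrite /A_se xy.
  by move=> x y; rewrite (le_trans (l1normB _ _)) // lerD.
have -> : pert = fun x => A_se sigma eta x + (pert x - A_se sigma eta x).
  by apply: funext => x; rewrite addrC subrK.
have H2 : 0 <= (k + k) * q ^+ 0 + H.
  exact: addr_ge0 (mulr_ge0 (addr_ge0 k0 k0) (exprn_ge0 _ q0)) H0.
have hK2 x : l1norm (A_se sigma eta x + (pert x - A_se sigma eta x)) <= k + K.
  by rewrite (le_trans (l1normD _ _)) // lerD.
exact: (proj1 (holder_l1_norm H2 (holder_l1D hAl hH) hK2)).
Qed.

End Perturbation.

(* With b = Λ 2^{nα}, the two outer shears cost O(Λ (2^{3α}/η^2)^n) and the
   middle one O(1/Λ). *)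
Lemma small_perturbation (R : realType) (alpha eta sigma eps : R) :
  0 < alpha -> 1 < eta -> eta < sigma -> powR 2 (3 * alpha) < eta ^+ 2 -> 0 < eps ->
  exists n (b : R), [/\ (1 < n)%N, 0 < b &
    let s := b / (eta ^+ 2) ^+ n in let t := b / (sigma ^+ 2) ^+ n in
    let q := powR 2 alpha in
    (eta * s + sigma / b + sigma * t) +
    (eta * s * q ^+ (n + n) + sigma / b * q ^+ n + sigma * t * q ^+ (n + n)) < eps].
Proof.
move=> alpha0 eta1 es qe eps0; set q := powR 2 alpha.
have eta0 : 0 < eta by exact: lt_trans eta1.
have sigma0 : 0 < sigma by exact: lt_trans es.
have q0 : 0 < q by rewrite powR_gt0.
have q1 : 1 <= q by rewrite -(powRr0 2) ler_powR ?ler1n // ltW.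
have q3 : powR 2 (3 * alpha) = q ^+ 3 by rewrite mulrC powRrM powR_mulrn // ltW.
have e2 : 0 < eta ^+ 2 by rewrite exprn_gt0.
pose rho := q ^+ 3 / eta ^+ 2.
have rho0 : 0 <= rho by rewrite divr_ge0 ?exprn_ge0 // ltW.
have rho1 : `|rho| < 1 by rewrite ger0_norm // ltr_pdivrMr // mul1r -q3.
(* This [L] makes the Hölder cost of the middle shear eps/8; the threshold on rho^n below makes each
   outer one at most eps/16. As q >= 1, the uniform sizes are no larger, and the total is at most
   eps/2. *)
pose L := 8 * sigma / eps.
have L0 : 0 < L by rewrite divr_gt0 // mulr_gt0.
have d0 : 0 < eps / (16 * sigma * L) by rewrite divr_gt0 // (mulr_gt0 _ L0) // mulr_gt0.
have /cvgr0Pnorm_le/(_ _ d0)[N _ hN] := cvg_expr rho1.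
(* The 2 ensures n > 1, and b = q^n L gives s q^(2n) = L rho^n. *)
pose n := (N + 2)%N; exists n, (q ^+ n * L).
have b0 : 0 < q ^+ n * L by rewrite mulr_gt0 // exprn_gt0.
split => //; first exact: leq_addl.
move=> s t q'; rewrite /q' -/q.
have rn : rho ^+ n <= eps / (16 * sigma * L).
  by apply: le_trans (ler_norm _) _; apply: hN; exact: leq_addr.
have s0 : 0 < s by rewrite divr_gt0 // !exprn_gt0.
have t0 : 0 < t by rewrite divr_gt0 // !exprn_gt0.
have ts : t <= s.
  rewrite /t /s ler_wpM2l ?(ltW b0) // lef_pV2 ?posrE ?exprn_gt0 //.
  by rewrite !lerXn2r ?nnegrE ?exprn_ge0 ?(ltW eta0) ?(ltW sigma0) ?(ltW es).
have qn1 : 1 <= q ^+ n by rewrite exprn_ege1.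
have qnn1 : 1 <= q ^+ (n + n) by rewrite exprn_ege1.
have sE : s * q ^+ (n + n) = L * rho ^+ n.
  rewrite /s /rho expr_div_n exprD -[q ^+ 3 ^+ n]exprM mulnC exprM.
  by field; rewrite gt_eqF ?exprn_gt0.
have bE : sigma / (q ^+ n * L) * q ^+ n = eps / 8.
  by rewrite /L; field; rewrite !gt_eqF ?exprn_gt0.
have main : sigma * (s * q ^+ (n + n)) <= eps / 16.
  rewrite sE; have := ler_wpM2l (ltW (mulr_gt0 sigma0 L0)) rn.
  rewrite (_ : sigma * L * (eps / (16 * sigma * L)) = eps / 16) ?mulrA //.
  by field; rewrite !gt_eqF.
have h0 : eta * s * q ^+ (n + n) <= sigma * (s * q ^+ (n + n)).
  by rewrite -mulrA ler_wpM2r ?(ltW es) // mulr_ge0 ?exprn_ge0 // ltW.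
have h1 : sigma * t * q ^+ (n + n) <= sigma * (s * q ^+ (n + n)).
  by rewrite -mulrA ler_wpM2l ?(ltW sigma0) // ler_wpM2r ?exprn_ge0 // ltW.
have h2 : eta * s <= eta * s * q ^+ (n + n).
  by rewrite ler_peMr // mulr_ge0 // ltW.
have h3 : sigma * t <= sigma * t * q ^+ (n + n).
  by rewrite ler_peMr // mulr_ge0 // ltW.
have h4 : sigma / (q ^+ n * L) <= sigma / (q ^+ n * L) * q ^+ n.
  by rewrite ler_peMr // divr_ge0 // ltW.
rewrite bE in h4 *; lra.
Qed.

(** * Discontinuity of the exponents at [A_se] *)

Theorem theoremA (R : realType) (p alpha eta sigma : R) :
  0 < p -> p < 1 -> 0 < alpha -> 1 < eta -> eta < sigma ->
  powR 2 (3 * alpha) < eta ^+ 2 ->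
  p / (1 - p) != ln eta / ln sigma ->
  (forall eps : R, 0 < eps ->
     exists B : shiftspace -> 'M[R]_2,
       SL2_valued B /\ holder alpha B /\
       holder_norm alpha (fun x => B x - A_se sigma eta x) < eps /\
       lyap_plus_eq p B 0 /\ lyap_minus_eq p B 0) /\
  (lyap_plus_eq p (A_se sigma eta) `|(1 - p) * ln eta - p * ln sigma| /\
   lyap_minus_eq p (A_se sigma eta) (- `|(1 - p) * ln eta - p * ln sigma|) /\
   `|(1 - p) * ln eta - p * ln sigma| != 0).
Proof.
move=> p0 p1 alpha0 eta1 es qe hne; split.
  move=> eps eps0.
  have [n [b [n1 b0 small]]] := small_perturbation alpha0 eta1 es qe eps0.
  exists (pert eta sigma b n).
  have [hB hBA] := pert_holder eta1 es b0 n1 alpha0.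
  have [plus minus] := pert_exponents eta1 es b0 n1 p0 p1.
  split; first exact: SL2_pert.
  by split => //; split => //; exact: le_lt_trans hBA small.
have [plus minus] := A_se_exponents p0 p1 eta1 es.
rewrite distrC; split => //; split => //.
(* A zero exponent would mean (1 - p) log eta = p log sigma, which is the excluded ratio. *)
rewrite normr_eq0; apply: contra hne; rewrite subr_eq0 => /eqP h.
have ls : ln sigma != 0 by rewrite gt_eqF // ln_gt0 // (lt_trans eta1).
have p2 : 1 - p != 0 by rewrite subr_eq0 eq_sym lt_eqF.
by rewrite eqr_div // h mulrC.
Qed.
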